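(* Let $\Omega\subseteq\mathbb{R}^n$ be an open bounded Lipschitz set, let $u\in SBV(\Omega;\mathbb{R}^m)$ be such that $\nabla u\in L^p(\Omega;\mathbb{R}^{m\times n})$ for some $p\in[1,\infty)$ and $g_0(|[u]|)\in L^1(\Omega;\mathcal{H}^{n-1}\llcorner J_u)$, where $g_0:[0,\infty)\to[0,\infty)$ is continuous, nondecreasing, subadditive, and $g_0^{-1}(0)=\{0\}$. Let $(u_j)_{j\in\mathbb{N}}$, $(\Phi_j)_{j\in\mathbb{N}}$ be an approximating sequence for $u$ (in the sense of the context). Then $$\lim_j\int_\Omega\Psi(\nabla u_j)\,dx=\int_\Omega\Psi(\nabla u)\,dx$$ and $$\lim_j\int_{J_{u_j}}g([u_j],\nu_{u_j})\,d\mathcal{H}^{n-1}=\int_{J_{u}}g([u],\nu_u)\,d\mathcal{H}^{n-1}$$ for all functions $\Psi\in C^0(\mathbb{R}^{m\times n})$ for which there is $C>0$ with $|\Psi(\xi)|\le C(|\xi|^p+1)$ for all $\xi$, and all $g\in C^0(\mathbb{R}^m\times S^{n-1};[0,\infty))$ satisfying: (a) $g(-s,-\nu)=g(s,\nu)$ for all $(s,\nu)\in\mathbb{R}^m\times S^{n-1}$; (b) there is $C>0$ such that $g(s+s',\nu)\le g(s,\nu)+C\,g_0(|s'|)$ for all $(s,s',\nu)\in\mathbb{R}^m\times\mathbb{R}^m\times S^{n-1}$; (c) $g(0,\nu)=0$ for all $\nu\in S^{n-1}$. In particular, $\lim_jE_{\Psi,g}[u_j,\Omega]=E_{\Psi,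g}[u,\Omega]$.
   Context: $SBV(\Omega;\mathbb{R}^m)$ is the set of $u\in BV(\Omega;\mathbb{R}^m)$ with $Du=\nabla u\,\mathcal{L}^n+[u]\otimes\nu_u\,\mathcal{H}^{n-1}\llcorner J_u$, where $\nabla u$ is the approximate gradient, $J_u\subseteq\Omega$ the jump set, $\nu_u$ its (measurably oriented) unit normal and $[u]=u^+-u^-$ the jump. $[u]$ is extended by $0$ outside $J_u$; the normals are set equal to $0$ outside the respective jump set. For a Borel set $A\subseteq\Omega$, $$E_{\Psi,g}[u,A]:=\int_A \Psi(\nabla u)\,dx+\int_{J_u\cap A}g([u],\nu_u)\,d\mathcal{H}^{n-1}.$$ A set $\Omega\subseteq\mathbb{R}^n$ is Lipschitz if for every $x\in\partial\Omega$ there are $\varepsilon_x>0$, a Lipschitz function $G_x:\mathbb{R}^{n-1}\to\mathbb{R}$ and an isometry $A_x:\mathbb{R}^n\to\mathbb{R}^n$ with $A_x0=x$ and $B_{\varepsilon_x}(x)\cap\Omega=B_{\varepsilon_x}(x)\cap A_x\{(y',y_n): y_n<G_x(y')\}$. Bilipschitz means injective and Lipschitz with Lipschitz inverse. Approximating sequence for $u$: sequences $u_j\in SBV\cap L^\infty(\Omega;\mathbb{R}^m)$ and $\Phi_j\in\mathrm{Lip}(\mathbb{R}^n;\mathbb{R}^n)$ such that (i) for each $j$ there is a locally finite decomposition of $\mathbb{R}^n$ in simplexes such that $u_j$ is affine in the interior (intersected with $\Omega$) of each of them; (ii) $u_j\to u$ in $L^1(\Omega;\mathbb{R}^m)$;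 (iii) $\nabla u_j\to\nabla u$ in $L^p(\Omega;\mathbb{R}^{m\times n})$; (iv) $\Phi_j$ is bilipschitz, $\Phi_j(x)-x\to 0$ in $L^\infty(\mathbb{R}^n;\mathbb{R}^n)$, $D\Phi_j\to\mathrm{Id}$ in $L^\infty(\mathbb{R}^n;\mathbb{R}^{n\times n})$, and $\Phi_j(x)=x$ for $x\in\mathbb{R}^n\setminus\Omega$; (v) for a suitable orientation of the normal $\nu_j=\nu_{u_j}$ to $J_{u_j}$, $\lim_j\int_{J_u\cup \Phi_j^{-1}(J_{u_j})}g_0(|[u]-[u_j]\circ\Phi_j|)\,d\mathcal{H}^{n-1}= 0$ and $\lim_j\int_{J_u\cup \Phi_j^{-1}(J_{u_j})}g_0(|[u]|+|[u_j]\circ\Phi_j|)\,|\nu_u - \nu_j\circ\Phi_j|\,d\mathcal{H}^{n-1}= 0$; (vi) if $\mathcal{H}^{n-1}(J_{u})<\infty$, then $\mathcal{H}^{n-1}(J_u\triangle\Phi_j^{-1}(J_{u_j}))\to0$; (vii) if $\nabla u=0$ $\mathcal{L}^n$-a.e. on $\Omega$, then $\nabla u_j=0$ $\mathcal{L}^n$-a.e. on $\Omega$ for all $j$; if $u\in W^{1,p}(\Omega;\mathbb{R}^m)$, then $u_j\in W^{1,p}(\Omega;\mathbb{R}^m)$ for all $j$. *)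

(* Defs.v *)
From HB Require Import structures.
From mathcomp Require Import all_boot all_order all_algebra.
From mathcomp Require Import all_classical all_reals all_analysis ess_sup_inf.

Set Implicit Arguments.
Unset Strict Implicit.
Unset Printing Implicit Defensive.
Import Order.TTheory GRing.Theory Num.Theory.
Import numFieldNormedType.Exports.
Local Open Scope classical_set_scope.
Local Open Scope ring_scope.

(* Vectors of R^n are row vectors. The library norm on matrices is the sup
   norm; it is used only for the topology and for qualitative Lipschitz
   conditions, where it is interchangeable with the Euclidean norm. *)
Section euclidean.
Context {R : realType}.

(* Euclidean norm of a vector, Frobenius norm of a matrix. *)
Definition enorm m n (A : 'M[R]_(m, n)) : R :=
  Num.sqrt (\sum_(i < m) \sum_(j < n) A i j ^+ 2).

Definition edot n (x y : 'rV[R]_n) : R := \sum_(i < n) x 0 i * y 0 i.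

Definition eball n (x : 'rV[R]_n) (r : R) : set 'rV[R]_n :=
  [set y | enorm (y - x) < r].

Definition ediam n (A : set 'rV[R]_n) : \bar R :=
  ereal_sup [set (enorm (xy.1 - xy.2))%:E | xy in A `*` A].

End euclidean.

Section outer_measures.
Context {R : realType}.
Local Open Scope ereal_scope.

Section cover.
Context {T : Type} (tau : set T -> \bar R).

Definition cover_outer (X : set T) : \bar R :=
  ereal_inf [set \sum_(k <oo) tau (F k) |
    F in [set F : (set T)^nat | X `<=` \bigcup_k F k]].

End cover.

Section cover_lemmas.
Context {T : pointedType} (tau : set T -> \bar R).
Hypotheses (tau0 : tau set0 = 0) (tau_ge0 : forall A, 0 <= tau A).

Let D := g_sigma_algebraType [set: set T].

Let measurableD (A : set D) : measurable A.
Proof. exact: sub_sigma_algebra. Qed.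

Let cover_outerE : cover_outer tau = @mu_ext _ D R tau.
Proof.
apply/funext => X; rewrite /cover_outer /mu_ext; congr (ereal_inf _).
apply/seteqP; split=> _ [F XF <-]; exists F => //.
by have [] := XF.
Qed.

Lemma cover_outer0 : cover_outer tau set0 = 0.
Proof. by rewrite cover_outerE; exact: (@mu_ext0 _ D). Qed.

Lemma cover_outer_ge0 A : 0 <= cover_outer tau A.
Proof. by rewrite cover_outerE; exact: (@mu_ext_ge0 _ D). Qed.

Lemma le_cover_outer :
  {homo cover_outer tau : A B / A `<=` B >-> A <= B}.
Proof. by rewrite cover_outerE; exact: (@le_mu_ext _ D). Qed.

Lemma cover_outer_sigma_subadditive : sigma_subadditive (cover_outer tau).
Proof. by rewrite cover_outerE; exact: (@mu_ext_sigma_subadditive _ D). Qed.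

End cover_lemmas.

Definition ebox n (a b : 'rV[R]_n) : set 'rV[R]_n :=
  [set x | forall i, (a 0 i <= x 0 i <= b 0 i)%R].

(* Volume of the smallest box containing A. The empty set is singled out
   because in R^0 the empty product of side lengths is 1. *)
Definition box_gauge n (A : set 'rV[R]_n) : \bar R :=
  if A == set0 then 0
  else ereal_inf [set (\prod_(i < n) (ab.2 0 i - ab.1 0 i))%R%:E |
         ab in [set ab : 'rV[R]_n * 'rV[R]_n | A `<=` ebox ab.1 ab.2]].

Lemma box_gauge0 n : box_gauge (@set0 'rV[R]_n) = 0.
Proof. by rewrite /box_gauge eqxx. Qed.

Lemma box_gauge_ge0 n (A : set 'rV[R]_n) : 0 <= box_gauge A.
Proof.
rewrite /box_gauge; case: eqP => // /eqP/set0P[x Ax].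
apply: le_ereal_inf_tmp => _ [[a b] /= Aab <-].
rewrite lee_fin; apply: prodr_ge0 => i _.
by have /andP[ax xb] := Aab _ Ax i; rewrite subr_ge0 (le_trans ax).
Qed.

Definition lebesgue_outer n : set 'rV[R]_n -> \bar R :=
  cover_outer (@box_gauge n).

HB.instance Definition _ n := isOuterMeasure.Build R 'rV[R]_n
  (@lebesgue_outer n)
  (cover_outer0 (@box_gauge0 n) (@box_gauge_ge0 n))
  (cover_outer_ge0 (@box_gauge_ge0 n))
  (@le_cover_outer _ (@box_gauge n))
  (cover_outer_sigma_subadditive (@box_gauge_ge0 n)).

(* Lebesgue measure of the unit ball of R^k, equal to 1 for k = 0. *)
Definition ball_volume (k : nat) : R :=
  fine (lebesgue_outer (eball (0 : 'rV[R]_k) 1%R)).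

Definition hausdorff_gauge n (k : nat) (delta : R) (A : set 'rV[R]_n) :
    \bar R :=
  if A == set0 then 0
  else if ediam A <= delta%:E
    then (ball_volume k * (fine (ediam A) / 2) ^+ k)%R%:E
  else +oo.

Definition hausdorff_outer n (k : nat) (X : set 'rV[R]_n) : \bar R :=
  ereal_sup [set cover_outer (@hausdorff_gauge n k delta) X |
    delta in [set delta : R | (0 < delta)%R]].

Section hausdorff_lemmas.
Context (n k : nat).

Lemma hausdorff_gauge0 delta : hausdorff_gauge k delta (@set0 'rV[R]_n) = 0.
Proof. by rewrite /hausdorff_gauge eqxx. Qed.

Lemma ball_volume_ge0 l : (0 <= ball_volume l)%R.
Proof. by apply: fine_ge0; exact: outer_measure_ge0. Qed.

Lemma ediam_ge0 (A : set 'rV[R]_n) : A !=set0 -> 0 <= ediam A.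
Proof.
move=> [x Ax]; apply: (@le_trans _ _ (enorm (x - x))%:E).
  by rewrite lee_fin sqrtr_ge0.
by apply: ereal_sup_ubound; exists (x, x).
Qed.

Lemma hausdorff_gauge_ge0 delta (A : set 'rV[R]_n) :
  0 <= hausdorff_gauge k delta A.
Proof.
rewrite /hausdorff_gauge; case: eqP => // /eqP/set0P A0.
case: ifP => // _; rewrite lee_fin mulr_ge0 ?ball_volume_ge0// exprn_ge0//.
by rewrite divr_ge0// fine_ge0// ediam_ge0.
Qed.

Let gauge0 := hausdorff_gauge0.
Let gauge_ge0 := hausdorff_gauge_ge0.

Lemma hausdorff_outer_ge0 (X : set 'rV[R]_n) : 0 <= hausdorff_outer k X.
Proof.
apply: le_trans (cover_outer_ge0 (gauge_ge0 1%R) X) _.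
by apply: ereal_sup_ubound; exists 1%R => /=.
Qed.

Lemma hausdorff_outer0 : hausdorff_outer k (@set0 'rV[R]_n) = 0.
Proof.
apply/eqP; rewrite eq_le hausdorff_outer_ge0 andbT.
apply: ge_ereal_sup => _ [d /= _ <-].
by rewrite (cover_outer0 (gauge0 d) (gauge_ge0 d)).
Qed.

Lemma le_hausdorff_outer :
  {homo @hausdorff_outer n k : A B / A `<=` B >-> A <= B}.
Proof.
move=> A B AB; apply: ge_ereal_sup => _ [d /= d0 <-].
apply: (@le_trans _ _ (cover_outer (@hausdorff_gauge n k d) B)).
  exact: le_cover_outer.
by apply: ereal_sup_ubound; exists d.
Qed.

Lemma hausdorff_outer_sigma_subadditive :
  sigma_subadditive (@hausdorff_outer n k).
Proof.
move=> F; apply: ge_ereal_sup => _ [d /= d0 <-].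
apply: le_trans (cover_outer_sigma_subadditive (gauge_ge0 d) F) _.
apply: lee_nneseries => [i _ _|i _].
  exact: (cover_outer_ge0 (gauge_ge0 d)).
by apply: ereal_sup_ubound; exists d.
Qed.

End hausdorff_lemmas.

HB.instance Definition _ n k := isOuterMeasure.Build R 'rV[R]_n
  (@hausdorff_outer n k) (hausdorff_outer0 n k) (@hausdorff_outer_ge0 n k)
  (@le_hausdorff_outer n k) (@hausdorff_outer_sigma_subadditive n k).

End outer_measures.

Section measures.
Context (R : realType).

(* Both measures live on the Caratheodory sigma-algebra of their outer
   measure; for the Lebesgue measure these are the Lebesgue sets. *)
Definition lebesgueO n : {outer_measure set 'rV[R]_n -> \bar R} :=
  @lebesgue_outer R n.

Definition lebesgueN n :
    {measure set (caratheodory_type (lebesgueO n)) -> \bar R} := lebesgueO n.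

Definition hausdorffO n k : {outer_measure set 'rV[R]_n -> \bar R} :=
  @hausdorff_outer R n k.

Definition hausdorff n k :
    {measure set (caratheodory_type (hausdorffO n k)) -> \bar R} :=
  hausdorffO n k.

Definition borelN n := g_sigma_algebraType (@open 'rV[R]_n).

End measures.

Section function_spaces.
Context {R : realType} {n : nat}.
Notation V := 'rV[R]_n.
Notation leb := (lebesgueN R n).

Definition memLp (p : R) (Om : set V) k l (F : V -> 'M[R]_(k, l)) : Prop :=
  (forall i j, measurable_fun (Om : set (caratheodory_type (lebesgueO R n)))
                 (fun x => F x i j)) /\
  (\int[leb]_(x in Om) (enorm (F x) `^ p)%:E < +oo)%E.

Definition cvgLp (p : R) (Om : set V) k l (F_ : nat -> V -> 'M[R]_(k, l))
    (F : V -> 'M[R]_(k, l)) : Prop :=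
  (forall j, memLp p Om (F_ j)) /\
  (\int[leb]_(x in Om) (enorm (F_ j x - F x) `^ p)%:E)%E @[j --> \oo]
    --> 0%E.

Definition memLoo (Om : set V) k l (F : V -> 'M[R]_(k, l)) : Prop :=
  (forall i j, measurable_fun (Om : set (caratheodory_type (lebesgueO R n)))
                 (fun x => F x i j)) /\
  exists M : R, {ae leb, forall x, Om x -> enorm (F x) <= M}.

(* Partial derivative along the directions listed in ks, the head last. *)
Definition partials (ks : seq 'I_n) (phi : V -> R^o) : V -> R^o :=
  foldr (fun k f x => 'D_(delta_mx 0 k) f x) phi ks.

Definition smooth (phi : V -> R^o) : Prop :=
  forall ks, continuous (partials ks phi) /\
    forall k x, derivable (partials ks phi) x (delta_mx 0 k).

(* C_c^infty(Om) *)
Definition test_function (Om : set V) (phi : V -> R^o) : Prop :=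
  [/\ smooth phi, compact (closure [set x | phi x != 0])
    & closure [set x | phi x != 0] `<=` Om].

(* Du = (Du i k) is the matrix of signed measures with
   int_Om u_i d_k phi dx = - int_Om phi d(Du i k); the integral against a
   charge goes through its Jordan decomposition, which does not depend on the
   Hahn decomposition (P, N). Only the Borel subsets of Om are constrained. *)
Definition distr_deriv_measure (Om : set V) m (u : V -> 'rV[R]_m)
    (Du : 'I_m -> 'I_n -> {charge set (borelN R n) -> \bar R}) : Prop :=
  forall phi, test_function Om phi ->
  forall i k P N (PN : hahn_decomposition (Du i k) P N),
    (\int[leb]_(x in Om) (u x 0%R i * 'D_(delta_mx 0%R k) phi x)%R%:E =
     - (\int[jordan_pos PN]_(x in Om) (phi x)%:E -
        \int[jordan_neg PN]_(x in Om) (phi x)%:E))%E.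

Definition BV (Om : set V) m (u : V -> 'rV[R]_m) : Prop :=
  memLp 1 Om u /\ exists Du, distr_deriv_measure Om u Du.

(* W^{1,p}(Om; R^m) *)
Definition sobolev1 (p : R) (Om : set V) m (u : V -> 'rV[R]_m) : Prop :=
  memLp p Om u /\ exists2 G : V -> 'M[R]_(m, n), memLp p Om G &
    forall phi, test_function Om phi -> forall i k,
    (\int[leb]_(x in Om) (u x 0%R i * 'D_(delta_mx 0%R k) phi x)%R%:E =
     - \int[leb]_(x in Om) (G x i k * phi x)%R%:E)%E.

Definition average (A : set V) (f : V -> R) : \bar R :=
  ((fine (leb A))^-1%:E * \int[leb]_(y in A) (f y)%:E)%E.

Definition approx_limit m (u : V -> 'rV[R]_m) (x : V) (z : 'rV[R]_m) : Prop :=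
  average (eball x r) (fun y => enorm (u y - z)) @[r --> 0^'+] --> 0%E.

Definition approx_differential m (u : V -> 'rV[R]_m) (x : V)
    (L : 'M[R]_(m, n)) : Prop :=
  exists2 z, approx_limit u x z &
    average (eball x r) (fun y => enorm (u y - z - (y - x) *m L^T) / r)
      @[r --> 0^'+] --> 0%E.

(* Set to 0 where u is not approximately differentiable. *)
Definition approx_grad m (u : V -> 'rV[R]_m) (x : V) : 'M[R]_(m, n) :=
  xget 0 [set L | approx_differential u x L].

Definition half_ball (x nu : V) (r : R) : set V :=
  eball x r `&` [set y | 0 < edot (y - x) nu].

(* a = u^+ is the one-sided limit on the side nu points to, b = u^-. *)
Definition approx_jump m (u : V -> 'rV[R]_m) (x : V) (a b : 'rV[R]_m)
    (nu : V) : Prop :=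
  [/\ a != b, enorm nu = 1,
    average (half_ball x nu r) (fun y => enorm (u y - a))
      @[r --> 0^'+] --> 0%E
  & average (half_ball x (- nu) r) (fun y => enorm (u y - b))
      @[r --> 0^'+] --> 0%E].

Definition jump_set (Om : set V) m (u : V -> 'rV[R]_m) : set V :=
  [set x | Om x /\ exists a b nu, approx_jump u x a b nu].

(* (s, nu) = ([u], nu_u) for one measurable orientation of J_u; both are
   extended by 0 outside J_u. Reversing nu at a point changes the sign of s. *)
Definition jump_pair (Om : set V) m (u : V -> 'rV[R]_m)
    (s : V -> 'rV[R]_m) (nu : V -> V) : Prop :=
  [/\ forall x, jump_set Om u x ->
        exists a b, approx_jump u x a b (nu x) /\ s x = a - b,
      forall x, ~ jump_set Om u x -> s x = 0 /\ nu x = 0,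
      measurable_fun setT (s : borelN R n -> borelN R m)
    & measurable_fun setT (nu : borelN R n -> borelN R n)].

End function_spaces.

(* From here on the ambient space is R^(n+1), so that the surface measure is
   the n-dimensional Hausdorff measure. *)
Section sbv.
Context {R : realType} {n : nat}.
Notation V := 'rV[R]_n.+1.
Notation leb := (lebesgueN R n.+1).
Notation surf := (hausdorff R n.+1 n).

(* Du is unique on the Borel subsets of Om. *)
Definition SBV (Om : set V) m (u : V -> 'rV[R]_m) : Prop :=
  BV Om u /\
  forall Du, distr_deriv_measure Om u Du ->
  exists s nu,
    [/\ jump_pair Om u s nu,
        memLp 1 Om (approx_grad u),
        forall i k, surf.-integrable (jump_set Om u)
                      (fun x => (s x 0 i * nu x 0 k)%:E)
      & forall i k (A : set (borelN R n.+1)), measurable A -> A `<=` Om ->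
          Du i k A = (\int[leb]_(x in A) (approx_grad u x i k)%:E +
            \int[surf]_(x in jump_set Om u `&` A)
              (s x 0%R i * nu x 0%R k)%R%:E)%E].

Definition bulk_energy m (Psi : 'M[R]_(m, n.+1) -> R) (u : V -> 'rV[R]_m)
    (A : set V) : \bar R :=
  \int[leb]_(x in A) (Psi (approx_grad u x))%:E.

Definition surface_energy m (g : 'rV[R]_m -> V -> R) (Om : set V)
    (u s : V -> 'rV[R]_m) (nu : V -> V) (A : set V) : \bar R :=
  \int[surf]_(x in jump_set Om u `&` A) (g (s x) (nu x))%:E.

(* E_{Psi,g}[u,A], with (s, nu) = ([u], nu_u) *)
Definition energy m (Psi : 'M[R]_(m, n.+1) -> R) (g : 'rV[R]_m -> V -> R)
    (Om : set V) (u s : V -> 'rV[R]_m) (nu : V -> V) (A : set V) : \bar R :=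
  (bulk_energy Psi u A + surface_energy g Om u s nu A)%E.

(* y = (y', y_n) with y' = col' ord_max y and y_n = y 0 ord_max *)
Definition lipschitz_set (Om : set V) : Prop :=
  forall x, (closure Om `\` interior Om) x ->
  exists (eps : R) (G : 'rV[R]_n -> R^o) (A : V -> V),
    [/\ 0 < eps, lipschitz G,
        forall y z, enorm (A y - A z) = enorm (y - z),
        A 0 = x
      & eball x eps `&` Om =
        eball x eps `&` A @` [set y : V | y 0 ord_max < G (col' ord_max y)]].

Definition bilipschitz (Phi : V -> V) : Prop :=
  [/\ injective Phi, lipschitz Phi
    & exists2 Phi' : V -> V, cancel Phi Phi'
        & [lipschitz Phi' y | y in range Phi]].

Definition is_simplex (T : set V) : Prop :=
  exists2 v : 'I_n.+2 -> V,
    (forall c : 'I_n.+2 -> R, \sum_i c i = 0 -> \sum_i c i *: v i = 0 ->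
       forall i, c i = 0)
  & T = [set x | exists t : 'I_n.+2 -> R,
      [/\ forall i, 0 <= t i, \sum_i t i = 1 & x = \sum_i t i *: v i]].

Definition simplicial_decomposition (S : set (set V)) : Prop :=
  [/\ forall T, S T -> is_simplex T,
      \bigcup_(T in S) T = setT,
      forall T T', S T -> S T' -> T <> T' ->
        interior T `&` interior T' = set0
    & forall x : V, exists2 U, nbhs x U &
        finite_set [set T | S T /\ T `&` U !=set0]].

Definition piecewise_affine (Om : set V) m (u : V -> 'rV[R]_m) : Prop :=
  exists2 S, simplicial_decomposition S &
    forall T, S T -> exists (A : 'M[R]_(n.+1, m)) (b : 'rV[R]_m),
      {ae leb, forall x, (interior T `&` Om) x -> u x = (x : V) *m A + b}.

(* Approximating sequence for u with chosen ([u], nu_u) = (s, nu).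
   'J f x is the transpose of the matrix Df(x), and is a junk value where f is
   not differentiable: hence the almost everywhere differentiability clause,
   which holds for every Lipschitz map by Rademacher's theorem. *)
Definition approximating_sequence (p : R) (g0 : R -> R) (Om : set V) m
    (u s : V -> 'rV[R]_m) (nu : V -> V)
    (u_ : nat -> V -> 'rV[R]_m) (Phi_ : nat -> V -> V) : Prop :=
  (forall j, SBV Om (u_ j) /\ memLoo Om (u_ j)) /\
  (forall j, lipschitz (Phi_ j)) /\
  (forall j, piecewise_affine Om (u_ j)) /\
  cvgLp 1 Om u_ u /\
  cvgLp p Om (fun j => approx_grad (u_ j)) (approx_grad u) /\
  [/\ forall j, bilipschitz (Phi_ j),
      ess_sup leb (fun x => (enorm (Phi_ j x - x))%:E) @[j --> \oo] --> 0%E,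
      forall j, {ae leb, forall x, differentiable (Phi_ j) (x : V)},
      ess_sup leb (fun x => (enorm ('J (Phi_ j) (x : V) - 1%:M))%:E)
        @[j --> \oo] --> 0%E
    & forall j x, ~ Om x -> Phi_ j x = x] /\
  (exists s_ nu_,
    [/\ forall j, jump_pair Om (u_ j) (s_ j) (nu_ j),
        (\int[surf]_(x in jump_set Om u `|` Phi_ j @^-1` jump_set Om (u_ j))
           (g0 (enorm (s x - s_ j (Phi_ j x))))%:E)%E
          @[j --> \oo] --> 0%E
      & (\int[surf]_(x in jump_set Om u `|` Phi_ j @^-1` jump_set Om (u_ j))
           (g0 (enorm (s x) + enorm (s_ j (Phi_ j x)))
            * enorm (nu x - nu_ j (Phi_ j x)))%R%:E)%E
          @[j --> \oo] --> 0%E]) /\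
  ((surf (jump_set Om u) < +oo)%E ->
    surf ((jump_set Om u `\` Phi_ j @^-1` jump_set Om (u_ j)) `|`
          (Phi_ j @^-1` jump_set Om (u_ j) `\` jump_set Om u))
      @[j --> \oo] --> 0%E) /\
  ({ae leb, forall x, Om x -> approx_grad u x = 0} ->
    forall j, {ae leb, forall x, Om x -> approx_grad (u_ j) x = 0}) /\
  (sobolev1 p Om u -> forall j, sobolev1 p Om (u_ j)).

End sbv.

(* Main.v *)
From mathcomp Require Import all_boot all_order all_algebra.
From mathcomp Require Import all_classical all_reals all_analysis ess_sup_inf.
From mathcomp Require Import measurable_realfun.
From mathcomp Require Import ring lra.
Require Import Defs.
Set Implicit Arguments.
Unset Strict Implicit.
Unset Printing Implicit Defensive.
Import Order.TTheory GRing.Theory Num.Theory.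
Import numFieldNormedType.Exports.
Local Open Scope classical_set_scope.
Local Open Scope ring_scope.

(** The bulk and the surface integrals converge separately, and both for the
    same reason: the difference of the integrands is bounded by an integrable
    function plus a multiple of a control whose integral tends to zero, and it
    is small wherever the control is small. Along a subsequence with summable
    controls the controls tend to zero almost everywhere, and dominated
    convergence applies (controlled_integrals_vanish).

    For the bulk the control is [|grad u_j - grad u| ^ p]; the growth of [Psi]
    gives the bound and its continuity the pointwise smallness
    (cvg_integral_growth).

    For the surface, extend jumps and normals by zero, so that all integrals
    run over the whole space, and pull the jump of [u_j] back by [Phi_j]. The
    control is the sum of the two integrands, in [g0], that are assumed to
    vanish in the limit. The subadditivity of [g] bounds its variation in the
    jump by [g0], and since [g] vanishes at zero jump also [g (s, nu) <= C g0
    |s|]. What remains is the variation of [g] in the normal at a fixed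
    nonzero jump [s]: there [g0 |s| > 0], so the control bounds the difference
    of the normals (surface_density_cvg).

    It remains to undo the change of variables. As [D Phi_j] tends to the
    identity in the essential supremum, [Phi_j - id] has a Lipschitz constant
    [c_j] that tends to zero. This needs an argument, since the derivative
    exists only almost everywhere: averages of a Lipschitz function over a
    small moving ball are compared with the derivative by dominated
    convergence (increment_le_derivative, near_identity_lipschitz). Once [c_j
    < 1], the map [Phi_j] is a bijection, [Phi_j] and its inverse have
    Lipschitz constants [1 + c_j] and [1 / (1 - c_j)], and Hausdorff integrals
    change at most by the powers of these constants, which tend to one
    (cvg_integral_near_identity).

    Finally the orientation of the jump set of [u_j] is arbitrary. Two
    orientations differ pointwise by a common sign of jump and normal, because
    one-sided approximate limits are unique (approx_jump_unique), and the
    evenness of [g] makes the integrand insensitive to that sign.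

    The measures are given as outer measures built from covers. The facts used
    about them are that Borel sets satisfy Caratheodory's criterion
    (lebesgue_half_space, hausdorff_half_space) and that boxes have their
    elementary volume (lebesgue_ebox_ge, lebesgue_ebox_le). *)

(** * The Euclidean norm *)

Section enorm_theory.
Context {R : realType}.

Lemma cauchy_schwarz_sum (I : finType) (a b : I -> R) :
  \sum_i a i * b i <=
  Num.sqrt (\sum_i a i ^+ 2) * Num.sqrt (\sum_i b i ^+ 2).
Proof.
set A := Num.sqrt _; set B := Num.sqrt _.
have A0 : 0 <= A by exact: sqrtr_ge0.
have B0 : 0 <= B by exact: sqrtr_ge0.
have A2 : A ^+ 2 = \sum_i a i ^+ 2.
  by rewrite sqr_sqrtr// sumr_ge0// => i _; exact: sqr_ge0.
have B2 : B ^+ 2 = \sum_i b i ^+ 2.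
  by rewrite sqr_sqrtr// sumr_ge0// => i _; exact: sqr_ge0.
have zero (c : I -> R) : \sum_i c i ^+ 2 = 0 -> forall i, c i = 0.
  move=> c0 i; apply/eqP; rewrite -sqrf_eq0; apply/eqP.
  by apply: (psumr_eq0P _ c0) => // k _; exact: sqr_ge0.
have [A00|An0] := eqVneq A 0.
  rewrite A00 mul0r big1// => i _.
  by rewrite zero ?mul0r// -A2 A00 expr0n.
have [B00|Bn0] := eqVneq B 0.
  rewrite B00 mulr0 big1// => i _.
  by rewrite [b i]zero ?mulr0// -B2 B00 expr0n.
have AB : 0 < A * B by rewrite mulr_gt0// lt0r ?An0 ?Bn0.
(* the nonnegative sum of squares below is 2 A B times the defect *)
have : 0 <= \sum_i (B * a i - A * b i) ^+ 2.
  by rewrite sumr_ge0// => i _; exact: sqr_ge0.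
have -> : \sum_i (B * a i - A * b i) ^+ 2 =
    2 * (A * B) * (A * B - \sum_i a i * b i).
  transitivity (B ^+ 2 * (\sum_i a i ^+ 2) + A ^+ 2 * (\sum_i b i ^+ 2)
      - 2 * (A * B) * \sum_i a i * b i).
    rewrite !mulr_sumr -big_split/= -sumrB; apply: eq_bigr => i _; ring.
  by rewrite -A2 -B2; ring.
by rewrite pmulr_rge0 ?subr_ge0// mulr_gt0.
Qed.

Section matrices.
Context {m n : nat}.
Implicit Types A B : 'M[R]_(m, n).

Lemma enormE A : enorm A = Num.sqrt (\sum_(ij : 'I_m * 'I_n) A ij.1 ij.2 ^+ 2).
Proof. by rewrite /enorm pair_bigA. Qed.

Lemma enorm_ge0 A : 0 <= enorm A.
Proof. exact: sqrtr_ge0. Qed.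

Lemma enorm_sqr A : enorm A ^+ 2 = \sum_(ij : 'I_m * 'I_n) A ij.1 ij.2 ^+ 2.
Proof. by rewrite enormE sqr_sqrtr// sumr_ge0// => i _; exact: sqr_ge0. Qed.

Lemma enorm0 : enorm (0 : 'M[R]_(m, n)) = 0.
Proof. by rewrite enormE big1 ?sqrtr0// => i _; rewrite mxE expr0n. Qed.

Lemma enormN A : enorm (- A) = enorm A.
Proof. by rewrite !enormE; under eq_bigr do rewrite mxE sqrrN. Qed.

Lemma enormB A B : enorm (A - B) = enorm (B - A).
Proof. by rewrite -enormN opprB. Qed.

Lemma enormZ (c : R) A : enorm (c *: A) = `|c| * enorm A.
Proof.
rewrite !enormE; under eq_bigr do rewrite mxE exprMn.
by rewrite -mulr_sumr sqrtrM ?sqr_ge0// sqrtr_sqr.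
Qed.

Lemma ler_enormD A B : enorm (A + B) <= enorm A + enorm B.
Proof.
rewrite -(@ler_pXn2r _ 2)// ?nnegrE ?addr_ge0 ?enorm_ge0//.
rewrite sqrrD !enorm_sqr.
have -> : \sum_ij (A + B) ij.1 ij.2 ^+ 2 = \sum_ij A ij.1 ij.2 ^+ 2 +
    (\sum_ij A ij.1 ij.2 * B ij.1 ij.2) *+ 2 + \sum_ij B ij.1 ij.2 ^+ 2.
  rewrite mulr2n -!big_split/=; apply: eq_bigr => i _; rewrite mxE; ring.
rewrite lerD2r lerD2l lerMn2r/= !enormE.
exact: (cauchy_schwarz_sum (fun ij => A ij.1 ij.2) (fun ij => B ij.1 ij.2)).
Qed.

Lemma ler_enormB A B : enorm A <= enorm B + enorm (A - B).
Proof. by rewrite -{1}(subrK B A) addrC ler_enormD// addrC. Qed.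

Lemma ler_dist_enorm A B : `|enorm A - enorm B| <= enorm (A - B).
Proof.
have AB := ler_enormB A B; have := ler_enormB B A.
by rewrite (enormB B A) ler_norml => BA; apply/andP; split; lra.
Qed.

Lemma entry_le_enorm A i j : `|A i j| <= enorm A.
Proof.
rewrite -sqrtr_sqr enormE ler_wsqrtr// (bigD1 (i, j))//= lerDl.
by rewrite sumr_ge0// => k _; exact: sqr_ge0.
Qed.

Lemma enorm_le_sum A : enorm A <= \sum_(ij : 'I_m * 'I_n) `|A ij.1 ij.2|.
Proof.
rewrite -(@ler_pXn2r _ 2)// ?nnegrE ?enorm_ge0 ?sumr_ge0// enorm_sqr.
rewrite expr2 mulr_suml; apply: ler_sum => ij _.
rewrite -(real_normK (num_real _)) expr2 ler_wpM2l//.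
by rewrite (bigD1 ij)//= lerDl sumr_ge0.
Qed.

Lemma enorm_eq0 A : enorm A = 0 -> A = 0.
Proof.
move=> A0; apply/matrixP => i j; rewrite mxE; apply/eqP.
by rewrite -normr_le0 -A0 entry_le_enorm.
Qed.

Lemma enorm_gt0 A : A != 0 -> 0 < enorm A.
Proof.
move=> An0; rewrite lt0r enorm_ge0 andbT.
by apply: contra_neq An0 => /enorm_eq0.
Qed.

(** The norm [`|A|] of a matrix is the maximum of its entries; it carries the
    topology, while all metric estimates are Euclidean. *)
Lemma mx_norm_le_enorm A : `|A| <= enorm A.
Proof.
have [->|/mx_norm_neq0[i Ai]] := eqVneq `|A| 0; first exact: enorm_ge0.
by rewrite [`|A|]Ai entry_le_enorm.
Qed.

Lemma entry_le_mx_norm A i j : `|A i j| <= `|A|.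
Proof.
rewrite [leRHS]mx_normrE.
by apply: (le_bigmax _ (fun ij : 'I_m * 'I_n => `|A ij.1 ij.2|) (i, j)).
Qed.

Lemma enorm_le_mx_norm A : enorm A <= (m * n)%:R * `|A|.
Proof.
rewrite (le_trans (enorm_le_sum A))//.
rewrite (le_trans (ler_sum _ (fun ij _ => entry_le_mx_norm A ij.1 ij.2)))//.
by rewrite sumr_const card_prod !card_ord mulr_natl.
Qed.

Lemma continuous_enorm : continuous (@enorm R m n : 'M[R]_(m, n) -> R).
Proof.
move=> A; apply/(@cvgrPdist_lt _ _ _ (nbhs A)) => e e0.
have : \forall B \near A, `|A - B| < e / (m * n).+1%:R.
  by apply/nbhs_normP; exists (e / (m * n).+1%:R) => //=; rewrite divr_gt0.
apply: filterS => B AB; rewrite (le_lt_trans (ler_dist_enorm _ _))//.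
rewrite (le_lt_trans (enorm_le_mx_norm _))//.
rewrite (@le_lt_trans _ _ ((m * n).+1%:R * `|A - B|))//.
  by rewrite ler_wpM2r// ler_nat.
by rewrite mulrC -ltr_pdivlMr.
Qed.

Lemma continuous_subl (c : 'M[R]_(m, n)) : continuous (fun A => A - c).
Proof.
by move=> A; apply: (@continuousB _ _ _ id (fun=> c)) => //; exact: cst_continuous.
Qed.

Lemma continuous_enormB (c : 'M[R]_(m, n)) :
  continuous (fun A : 'M[R]_(m, n) => enorm (A - c)).
Proof.
move=> A; apply: (@continuous_comp _ _ _ (fun A => A - c)).
  exact: continuous_subl.
exact: continuous_enorm.
Qed.

End matrices.

Lemma edotC n (x y : 'rV[R]_n) : edot x y = edot y x.
Proof. by apply: eq_bigr => i _; rewrite mulrC. Qed.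

Lemma edotDl n (x y z : 'rV[R]_n) : edot (x + y) z = edot x z + edot y z.
Proof. by rewrite -big_split; apply: eq_bigr => i _; rewrite mxE mulrDl. Qed.

Lemma edotDr n (x y z : 'rV[R]_n) : edot x (y + z) = edot x y + edot x z.
Proof. by rewrite edotC edotDl !(edotC x). Qed.

Lemma edotZl n c (x z : 'rV[R]_n) : edot (c *: x) z = c * edot x z.
Proof. by rewrite /edot mulr_sumr; apply: eq_bigr => i _; rewrite mxE mulrA. Qed.

Lemma edotNl n (x z : 'rV[R]_n) : edot (- x) z = - edot x z.
Proof. by rewrite -scaleN1r edotZl mulN1r. Qed.

Lemma continuous_edotl n (v : 'rV[R]_n) : continuous (fun y => edot y v).
Proof.
apply: continuous_big; first exact: add_continuous.
move=> i _ y; apply: (@continuousM _ _ (fun y : 'rV[R]_n => y 0 i) (fun=> v 0 i)).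
  exact: coord_continuous.
exact: cst_continuous.
Qed.

Lemma row_enormE n (x : 'rV[R]_n) :
  enorm x = Num.sqrt (\sum_i x 0 i ^+ 2).
Proof. by rewrite /enorm big_ord_recl big_ord0 addr0. Qed.

Lemma edotxx n (x : 'rV[R]_n) : edot x x = enorm x ^+ 2.
Proof.
rewrite row_enormE sqr_sqrtr; first by apply: eq_bigr => i _; rewrite expr2.
by rewrite sumr_ge0// => i _; exact: sqr_ge0.
Qed.

Lemma ler_edot n (x y : 'rV[R]_n) : edot x y <= enorm x * enorm y.
Proof.
by rewrite !row_enormE; exact: (cauchy_schwarz_sum (fun i => x 0 i)).
Qed.

Lemma ler_norm_edot n (x y : 'rV[R]_n) : `|edot x y| <= enorm x * enorm y.
Proof.
by rewrite ler_norml ler_edot lerNl -edotNl (le_trans (ler_edot _ _))// enormN.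
Qed.

Lemma ler_enorm_mulmx n k (v : 'rV[R]_n) (M : 'M[R]_(n, k)) :
  enorm (v *m M) <= enorm v * enorm M.
Proof.
rewrite -(@ler_pXn2r _ 2)// ?nnegrE ?mulr_ge0 ?enorm_ge0// exprMn.
rewrite row_enormE sqr_sqrtr; last by apply: sumr_ge0 => i _; exact: sqr_ge0.
rewrite (enorm_sqr M) -(pair_bigA _ (fun i j => M i j ^+ 2))/= exchange_big/=.
rewrite mulr_sumr; apply: ler_sum => j _.
have Mj0 : 0 <= \sum_i M i j ^+ 2 by apply: sumr_ge0 => i _; exact: sqr_ge0.
rewrite -[X in _ * X]sqr_sqrtr// -exprMn -real_normK ?num_real//.
rewrite ler_pXn2r// ?nnegrE ?mulr_ge0 ?enorm_ge0 ?sqrtr_ge0//.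
rewrite mxE row_enormE ler_norml lerNl.
apply/andP; split; last exact: (cauchy_schwarz_sum (fun i => v 0 i)).
rewrite (_ : - _ = \sum_i (- v) 0 i * M i j); last first.
  by rewrite -sumrN; apply: eq_bigr => i _; rewrite mxE mulNr.
by rewrite -row_enormE -(enormN v) row_enormE; exact: cauchy_schwarz_sum.
Qed.

End enorm_theory.

(** * Measurability of matrix-valued maps *)

Lemma ae_imply d (T : measurableType d) (R : realType)
    (mu : {measure set T -> \bar R}) (P Q : T -> Prop) :
  (forall x, P x -> Q x) -> {ae mu, forall x, P x} -> {ae mu, forall x, Q x}.
Proof.
move=> PQ [N [mN N0 PN]]; exists N; split => // x nQ.
by apply: PN => Px; exact/nQ/PQ.
Qed.

Lemma ae_imply2 d (T : measurableType d) (R : realType)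
    (mu : {measure set T -> \bar R}) (P P' Q : T -> Prop) :
  (forall x, P x -> P' x -> Q x) ->
  {ae mu, forall x, P x} -> {ae mu, forall x, P' x} -> {ae mu, forall x, Q x}.
Proof.
move=> PQ [N [mN N0 PN]] [N' [mN' N'0 PN']]; exists (N `|` N'); split.
- exact: measurableU.
- exact: null_set_setU.
move=> x nQ; apply: contrapT => /not_orP[nN nN']; apply: nQ.
by apply: PQ; apply: contrapT => nP; [exact/nN/PN|exact/nN'/PN'].
Qed.

Section matrix_valued_measurability.
Context {R : realType} {k l : nat}.

Let ratbox (p : 'M[rat]_(k, l) * 'M[rat]_(k, l)) : set 'M[R]_(k, l) :=
  [set M | forall i j, ratr (p.1 i j) < M i j < ratr (p.2 i j)].

(** Boxes with rational corners form a countable base, so that measurability of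
    a matrix-valued map can be tested on its entries. *)
Lemma open_ratbox_cover (O : set 'M[R]_(k, l)) : open O ->
  O = \bigcup_p (if pselect (ratbox p `<=` O) then ratbox p else set0).
Proof.
move=> oO; apply/seteqP; split => [M OM|M [p _]]; last first.
  by case: pselect => // pO; exact: pO.
have /nbhs_ballP[e /= e0 eO] : nbhs M O by exact: open_nbhs_nbhs.
have lo i j : {q : rat | M i j - e < ratr q < M i j}.
  apply: cid; have [|q] := @rat_in_itvoo R (M i j - e) (M i j).
    by rewrite ltrBlDr ltrDl.
  by rewrite in_itv/= => ?; exists q.
have hi i j : {q : rat | M i j < ratr q < M i j + e}.
  apply: cid; have [|q] := @rat_in_itvoo R (M i j) (M i j + e).
    by rewrite ltrDl.
  by rewrite in_itv/= => ?; exists q.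
exists (\matrix_(i, j) sval (lo i j), \matrix_(i, j) sval (hi i j)) => //.
case: (pselect _) => [pO i j|]; last first.
  case=> N NB; apply: eO; split => // i j.
  have := NB i j; rewrite /= !mxE /ball/=.
  case: (lo i j) => ? /= /andP[+ _]; case: (hi i j) => ? /= /andP[_].
  by rewrite ltr_norml; lra.
rewrite /= !mxE.
by case: (lo i j) => ? /= /andP[_ ->]; case: (hi i j) => ? /= /andP[->].
Qed.

Context d (T : measurableType d) (D : set T) (f : T -> 'M[R]_(k, l)).
Hypothesis mf : forall i j, measurable_fun D (fun x => f x i j).

Lemma measurable_preimage_open O : measurable D -> open O ->
  measurable (D `&` f @^-1` O).
Proof.
move=> mD oO; rewrite (open_ratbox_cover oO) preimage_bigcup setI_bigcupr.
apply: countable_bigcupT_measurable => // p.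
case: pselect => pO /=; last by rewrite preimage_set0 setI0.
rewrite (_ : _ `&` _ = D `&` \bigcap_(ij in [set: 'I_k * 'I_l])
    (D `&` (fun x => f x ij.1 ij.2) @^-1` `]ratr (p.1 ij.1 ij.2), ratr (p.2 ij.1 ij.2)[)).
  apply: measurableI => //; apply: fin_bigcap_measurable => // -[i j] _.
  exact: mf.
apply/seteqP; split => x /=.
  move=> [Dx px]; split => // -[i j] _; split => //=.
  by rewrite in_itv/=; exact: px.
move=> [Dx H]; split => // i j.
by have [_] := H (i, j) Logic.I; rewrite /= in_itv.
Qed.

Lemma measurable_within_continuous (A : set 'M[R]_(k, l))
    (h : 'M[R]_(k, l) -> R) :
  {within A, continuous h} -> (forall x, D x -> A (f x)) ->
  measurable_fun D (h \o f).
Proof.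
move=> /continuousP ch DA mD.
apply: (measurability _ (RGenOpens.measurableE R)) => //.
move=> _ [_ [a [b ->] <-]].
have /open_subspaceP[V oV VA] := ch _ (@interval_open R (BRight a) (BLeft b) isT isT).
rewrite (_ : _ `&` _ = D `&` f @^-1` V); first exact: measurable_preimage_open.
apply/seteqP; split => x [Dx] H; split => //.
  by have [] : (V `&` A) (f x) by rewrite VA; split => //; exact: DA.
by have [] : (h @^-1` `]a, b[ `&` A) (f x) by rewrite -VA; split => //; exact: DA.
Qed.

Lemma measurable_continuous (h : 'M[R]_(k, l) -> R) :
  continuous h -> measurable_fun D (h \o f).
Proof.
move=> ch; apply: (@measurable_within_continuous setT) => //.
exact: continuous_subspaceT.
Qed.

Lemma measurable_enorm : measurable_fun D (fun x => enorm (f x)).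
Proof. exact/measurable_continuous/continuous_enorm. Qed.

End matrix_valued_measurability.

Section borel.
Context {R : realType}.

Lemma borel_open n (O : set 'rV[R]_n) : open O ->
  measurable (O : set (borelN R n)).
Proof. exact: sub_sigma_algebra. Qed.

Lemma borel_continuous n (h : 'rV[R]_n -> R) : continuous h ->
  measurable_fun setT (h : borelN R n -> R).
Proof.
move=> /continuousP ch mT.
apply: (measurability _ (RGenOpens.measurableE R)) => //.
move=> _ [_ [a [b ->] <-]]; rewrite setTI; apply: borel_open.
exact/ch/interval_open.
Qed.

Lemma borel_coord n i j :
  measurable_fun setT (fun x : borelN R n => (x : 'rV[R]_n) i j).
Proof. by apply: (@borel_continuous n (fun x => x i j)); exact: coord_continuous. Qed.

Lemma measurable_borelP d (T : measurableType d) (D : set T) n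
    (f : T -> borelN R n) : measurable_fun D f <->
  forall i j, measurable_fun D (fun x => (f x : 'rV[R]_n) i j).
Proof.
split=> [mf i j|mf mD].
  exact: (measurableT_comp (borel_coord i j) mf).
apply: (@measurability _ _ T (borelN R n) D f (@open 'rV[R]_n) erefl) => //.
move=> _ [U oU <-].
exact: measurable_preimage_open.
Qed.

(** Half-spaces generate the Borel sets, so Caratheodory's criterion need only
    be checked on them. *)
Lemma borel_caratheodory n (mu : {outer_measure set 'rV[R]_n -> \bar R}) :
  (forall i (c : R), mu.-caratheodory [set x : 'rV[R]_n | x 0 i < c]) ->
  measurable_fun setT (id : caratheodory_type mu -> borelN R n).
Proof.
move=> half; apply/measurable_borelP => i j.
apply: (measurability _ (RGenInftyO.measurableE R)).
move=> _ [_ [c ->] <-].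
rewrite setTI (_ : _ @^-1` _ = [set x : 'rV[R]_n | x 0 j < c]).
  exact: half.
by apply/seteqP; split => x; rewrite /= ord1 in_itv.
Qed.

End borel.

(** * Borel sets are Caratheodory measurable *)

Section cover_outer_split.
Context {R : realType}.
Local Open Scope ereal_scope.

(** Intersecting a cover with [A] and with [B] yields covers of both parts, so
    superadditivity passes from the gauge to the outer measure. *)
Lemma cover_outer_split (T : pointedType) (tau : set T -> \bar R) (A B : set T) :
  (forall G, 0 <= tau G) ->
  (forall G, tau (G `&` A) + tau (G `&` B) <= tau G) ->
  forall X, cover_outer tau (X `&` A) + cover_outer tau (X `&` B) <=
    cover_outer tau X.
Proof.
move=> tau0 split X; apply: le_ereal_inf_tmp => _ [F XF <-].
apply: (@le_trans _ _
    (\sum_(k <oo) tau (F k `&` A) + \sum_(k <oo) tau (F k `&` B))).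
  apply: leeD; apply: ereal_inf_lbound; [exists (fun k => F k `&` A)|
    exists (fun k => F k `&` B)] => //= x [/XF[k _ Fx] Ax]; by exists k.
rewrite -nneseriesD//; apply: lee_nneseries => // i _ _.
by rewrite adde_ge0.
Qed.

End cover_outer_split.

Section lebesgue_half_spaces.
Context {R : realType}.

(** The hyperplane cuts an enclosing box into two boxes whose volumes add up. *)
Lemma box_gauge_split n (i : 'I_n) (c : R) (G : set 'rV[R]_n) :
  (box_gauge (G `&` [set x | (x 0 i < c)%R]) +
   box_gauge (G `&` ~` [set x | (x 0 i < c)%R]) <= box_gauge G)%E.
Proof.
set A := [set x | _].
have [GA|GA] := eqVneq (G `&` A) set0.
  rewrite GA box_gauge0 add0e (_ : _ `&` _ = G)//.
  apply/seteqP; split => x; first by case.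
  by move=> Gx; split => // Ax; move: GA; rewrite -subset0 => /(_ x); apply.
have [GB|GB] := eqVneq (G `&` ~` A) set0.
  rewrite GB box_gauge0 adde0 (_ : _ `&` _ = G)//.
  apply/seteqP; split => x; first by case.
  move=> Gx; split => //; apply: contrapT => Ax.
  by move: GB; rewrite -subset0 => /(_ x); apply.
move/set0P: (GA) => [x [Gx Ax]]; move/set0P: (GB) => [y [Gy By]].
rewrite {3}/box_gauge ifF; last by apply/negP => /eqP G0; move: Gx; rewrite G0.
apply: le_ereal_inf_tmp => _ [[a b] /= Gab <-].
have ax := Gab _ Gx i; have bY := Gab _ Gy i.
move: By => /= /negP; rewrite -leNgt => By; rewrite /A/= in Ax.
pose b' := \row_j (if j == i then c else b 0 j).
pose a' := \row_j (if j == i then c else a 0 j).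
pose v := (\prod_(j < n | j != i) (b 0 j - a 0 j)).
rewrite (_ : \prod_(j < n) (b 0 j - a 0 j) =
    \prod_(j < n) (b' 0 j - a 0 j) + \prod_(j < n) (b 0 j - a' 0 j)); last first.
  rewrite (bigD1 i)//= [X in _ = X + _](bigD1 i)//= [X in _ = _ + X](bigD1 i)//=.
  rewrite !mxE eqxx [X in _ = _ * X + _](eq_bigr (fun j => b 0 j - a 0 j)); last first.
    by move=> j /negbTE ji; rewrite /b' mxE ji.
  rewrite [X in _ = _ + _ * X](eq_bigr (fun j => b 0 j - a 0 j)); last first.
    by move=> j /negbTE ji; rewrite /a' mxE ji.
  by ring.
rewrite EFinD; apply: leeD; rewrite /box_gauge ifF; try exact/negbTE.
  apply: ereal_inf_lbound; exists (a, b') => //= z [/Gab abz Az] j /=.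
  rewrite mxE; case: eqP => [->|_]; last exact: abz.
  by have /andP[-> _] := abz i; rewrite /= ltW.
apply: ereal_inf_lbound; exists (a', b) => //= z [/Gab abz] /negP.
rewrite -leNgt => Az j /=; rewrite mxE; case: eqP => [->|_]; last exact: abz.
by have /andP[_ ->] := abz i; rewrite Az.
Qed.

Lemma lebesgue_half_space n i (c : R) :
  (lebesgueO R n).-caratheodory [set x : 'rV[R]_n | x 0 i < c].
Proof.
apply: le_caratheodory_measurable; apply: cover_outer_split.
  exact: box_gauge_ge0.
exact: box_gauge_split.
Qed.

Lemma lebesgue_borel n : measurable_fun setT
  (id : caratheodory_type (lebesgueO R n) -> borelN R n).
Proof. by apply: borel_caratheodory => i c; exact: lebesgue_half_space. Qed.

Lemma lebesgue_open n (U : set 'rV[R]_n) : open U ->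
  measurable (U : set (caratheodory_type (lebesgueO R n))).
Proof.
move=> oU; have := @lebesgue_borel n measurableT U (borel_open oU).
by rewrite setTI.
Qed.

End lebesgue_half_spaces.

Section hausdorff_half_spaces.
Context {R : realType} {n : nat}.
Notation V := 'rV[R]_n.
Local Open Scope ereal_scope.

Lemma ediam_ubound (F : set V) x y : F x -> F y -> (enorm (x - y))%:E <= ediam F.
Proof. by move=> Fx Fy; apply: ereal_sup_ubound; exists (x, y). Qed.

Lemma le_ediam (F G : set V) : G `<=` F -> ediam G <= ediam F.
Proof.
move=> GF; apply: le_ereal_sup => _ [[x y] [/= Gx Gy] <-].
by exists (x, y) => //; split; exact: GF.
Qed.

Lemma le_hausdorff_gauge k delta (F G : set V) : G `<=` F ->
  hausdorff_gauge k delta G <= hausdorff_gauge k delta F.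
Proof.
move=> GF; rewrite {1}/hausdorff_gauge.
have [_|G0] := eqVneq G set0; first exact: hausdorff_gauge_ge0.
have F0 : F != set0.
  by move/set0P : G0 => [x Gx]; apply/set0P; exists x; exact: GF.
rewrite /hausdorff_gauge (negbTE F0); case: (leP (ediam F)) => [Fd|]; last first.
  by rewrite leey.
rewrite (le_trans (le_ediam GF) Fd) lee_fin.
have G0' : 0 <= ediam G by apply: ediam_ge0; exact/set0P.
have fF : ediam F \is a fin_num.
  rewrite ge0_fin_numE; first by rewrite (le_lt_trans Fd) ?ltry.
  by apply: ediam_ge0; exact/set0P.
have fG : ediam G \is a fin_num.
  by rewrite ge0_fin_numE// (le_lt_trans (le_ediam GF))// ltey_eq fF.
have F0' := le_trans G0' (le_ediam GF).
rewrite ler_wpM2l ?ball_volume_ge0// lerXn2r ?nnegrE ?divr_ge0 ?fine_ge0//.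
by rewrite ler_wpM2r ?invr_ge0// fine_le// le_ediam.
Qed.

Lemma hausdorff_ubound k delta (X : set V) : (0 < delta)%R ->
  cover_outer (@hausdorff_gauge R n k delta) X <= hausdorff_outer k X.
Proof. by move=> d0; apply: ereal_sup_ubound; exists delta. Qed.

Lemma le_delta_hausdorff k (d1 d2 : R) (X : set V) : (d1 <= d2)%R ->
  cover_outer (@hausdorff_gauge R n k d2) X <=
  cover_outer (@hausdorff_gauge R n k d1) X.
Proof.
move=> d12; apply: le_ereal_inf_tmp => _ [F XF <-].
apply: le_trans (_ : \sum_(j <oo) hausdorff_gauge k d2 (F j) <= _).
  by apply: ereal_inf_lbound; exists F.
apply: lee_nneseries => [i _ _|i _]; first exact: hausdorff_gauge_ge0.
rewrite /hausdorff_gauge; case: eqP => // _.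
case: (leP (ediam (F i)) d1%:E) => [Fd1|_]; last by rewrite leey.
by rewrite (le_trans Fd1)// lee_fin.
Qed.

(** Sets at positive distance are covered by disjoint families of small sets,
    so the outer measure adds up on them. *)
Lemma hausdorff_separated k (i : 'I_n) (c1 c2 : R) (P Q X : set V) :
  (c1 < c2)%R -> P `<=` X `&` [set x : V | (x 0 i <= c1)%R] ->
  Q `<=` X `&` [set x : V | (c2 < x 0 i)%R] ->
  hausdorff_outer k P + hausdorff_outer k Q <= hausdorff_outer k X.
Proof.
move=> c12 PX QX.
have [->|Xoo] := eqVneq (hausdorff_outer k X) +oo; first by rewrite leey.
have fX : hausdorff_outer k X \is a fin_num.
  by rewrite ge0_fin_numE ?hausdorff_outer_ge0// ltey.
(* a set of diameter less than [c2 - c1] cannot meet both parts *)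
have sub d : (0 < d < c2 - c1)%R ->
    cover_outer (@hausdorff_gauge R n k d) P +
    cover_outer (@hausdorff_gauge R n k d) Q <= hausdorff_outer k X.
  move=> /andP[d0 dc]; apply: le_trans (hausdorff_ubound k X d0).
  apply: le_trans (cover_outer_split
      (A := [set x : V | (x 0 i <= c1)%R]) (B := [set x : V | (c2 < x 0 i)%R])
      (hausdorff_gauge_ge0 k d) _ X).
    by apply: leeD; apply: le_cover_outer.
  move=> G; set GA := G `&` _; set GB := G `&` _.
  have [GA0|/set0P[x [Gx xA]]] := eqVneq GA set0.
    by rewrite GA0 hausdorff_gauge0 add0e; apply: le_hausdorff_gauge => x [].
  have [GB0|/set0P[y [Gy yB]]] := eqVneq GB set0.
    by rewrite GB0 hausdorff_gauge0 adde0; apply: le_hausdorff_gauge => y [].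
  rewrite {3}/hausdorff_gauge ifF; last by apply/negP => /eqP G0; move: Gx; rewrite G0.
  rewrite ifF ?leey//; apply/negbTE; rewrite -ltNge.
  apply: lt_le_trans (ediam_ubound Gy Gx); rewrite lte_fin.
  apply: lt_le_trans dc _; apply: le_trans (entry_le_enorm _ 0%R i).
  by rewrite !mxE; rewrite /= in xA yB; rewrite (le_trans _ (ler_norm _))//; lra.
have sub2 d1 d2 : (0 < d1)%R -> (0 < d2)%R ->
    cover_outer (@hausdorff_gauge R n k d1) P +
    cover_outer (@hausdorff_gauge R n k d2) Q <= hausdorff_outer k X.
  move=> d10 d20; pose d := (Num.min (Num.min d1 d2) ((c2 - c1) / 2))%R.
  have dd : (0 < d < c2 - c1)%R.
    by rewrite /d !lt_min !gt_min d10 d20/=; apply/andP; split; lra.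
  apply: le_trans (sub _ dd); apply: leeD; apply: le_delta_hausdorff.
    by rewrite /d !ge_min lexx.
  by rewrite /d !ge_min lexx !orbT.
have fQ d : (0 < d)%R -> cover_outer (@hausdorff_gauge R n k d) Q \is a fin_num.
  move=> d0; rewrite ge0_fin_numE; last exact/cover_outer_ge0/hausdorff_gauge_ge0.
  apply: (@le_lt_trans _ _ (hausdorff_outer k X)); last by rewrite ltey_eq fX.
  apply: le_trans (sub2 d d d0 d0); rewrite leeDr//.
  exact/cover_outer_ge0/hausdorff_gauge_ge0.
have fP : hausdorff_outer k P \is a fin_num.
  rewrite ge0_fin_numE ?hausdorff_outer_ge0//.
  apply: (@le_lt_trans _ _ (hausdorff_outer k X)); last by rewrite ltey_eq fX.
  by apply: le_hausdorff_outer => x /PX[].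
rewrite addeC -leeBrDr//; apply: ge_ereal_sup => _ [d2 d20 <-].
rewrite leeBrDr// addeC -leeBrDr ?fQ//; apply: ge_ereal_sup => _ [d1 d10 <-].
by rewrite leeBrDr ?fQ// sub2.
Qed.

(** The set [x_i < c] is exhausted by the sets [x_i <= c - 1 / (j + 1)]. The
    shells between consecutive ones are alternately separated, which bounds
    the sum of their measures, so that its tails vanish. *)
Lemma hausdorff_half_space k i (c : R) :
  (hausdorffO R n k).-caratheodory [set x : V | (x 0 i < c)%R].
Proof.
apply: le_caratheodory_measurable => X.
set A := [set x : V | _]; pose H := @hausdorff_outer R n k.
change (H (X `&` A) + H (X `&` ~` A) <= H X).
have [->|Xoo] := eqVneq (H X) +oo; first by rewrite leey.
have fX : H X \is a fin_num by rewrite ge0_fin_numE ?hausdorff_outer_ge0// ltey.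
pose t j : R := (c - j.+1%:R^-1)%R.
have tS j : (t j < t j.+1)%R.
  by rewrite ltrD2l ltrN2 ltf_pV2 ?posrE// ltr_nat.
pose P j := X `&` [set x : V | (x 0 i <= t j)%R].
pose S j := X `&` [set x : V | (t j < x 0 i <= t j.+1)%R].
have PX j : H (P j) <= H X by apply: le_hausdorff_outer => x [].
have shell j : H (P j) + H (S j.+1) <= H (P j.+2).
  apply: (@hausdorff_separated k i _ _ _ _ _ (tS j)) => x [Xx] /=.
    move=> xj; do !split => //=.
    by rewrite (le_trans xj)// ltW// (lt_trans (tS j)).
  by move=> /andP[x1 x2]; do !split => //=.
have sumS N : \sum_(0 <= j < N) H (S j.+1) <= H (P N) + H (P N.+1).
  elim: N => [|N IH].
    by rewrite big_nil adde_ge0// hausdorff_outer_ge0.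
  rewrite big_nat_recr//=; apply: le_trans (leeD2r _ IH) _.
  by rewrite addeAC addeC leeD2l.
have Soo : \sum_(j <oo) H (S j.+1) < +oo.
  apply: (@le_lt_trans _ _ (H X + H X)); last by rewrite ltey_eq fin_numD fX.
  apply: lime_le; first by apply: is_cvg_nneseries => *; exact: hausdorff_outer_ge0.
  by apply: nearW => N; rewrite (le_trans (sumS N))// leeD.
have tail : \sum_(N <= j <oo) H (S j.+1) @[N --> \oo] --> 0.
  by apply: nneseries_tail_cvg => // j _; exact: hausdorff_outer_ge0.
have XA N : H (X `&` A) <= H (P N.+1) + \sum_(N <= j <oo) H (S j.+1).
  apply: le_trans (_ : H (P N.+1 `|` \bigcup_(j in ~` `I_N) S j.+1) <= _).
    apply: le_hausdorff_outer => x [Xx xc].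
    have [xN|xN] := leP (x 0%R i) (t N.+1); first by left.
    right; have [|j xj jmin] := @ex_minnP (fun j => (x 0 i <= t j)%R).
      have d0 : (0 < c - x 0 i)%R by rewrite subr_gt0.
      have [N' _ H'] := near_infty_natSinv_lt (PosNum d0).
      exists N'; have := H' N' (leqnn _); by rewrite /t /= ltrBrDr lerBrDr addrC => /ltW.
    case: j xj jmin => [x0 _|[x1 _|j xj jmin]].
    - exfalso; move: x0; rewrite leNgt (le_lt_trans _ xN)//.
      elim: (N) => [|N0 IH]; first by rewrite ltW.
      by rewrite (le_trans IH)// ltW.
    - exfalso; move: x1; rewrite leNgt (le_lt_trans _ xN)//.
      elim: (N) => [//|N0 IH].
      by rewrite (le_trans IH)// ltW.
    - exists j => /=.
        apply/negP; rewrite -leqNgt leqNgt; apply/negP => jN.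
        move: xj; rewrite leNgt (le_lt_trans _ xN)//.
        have := jN; elim: (N) => // N0 IH; rewrite ltnS leq_eqVlt.
        by move=> /predU1P[->//|/IH/le_trans]; apply; rewrite ltW.
      split => //=; rewrite xj andbT ltNge; apply/negP => /jmin.
      by rewrite ltnn.
  apply: le_trans (outer_measureU2 (hausdorffO R n k) _ _) _.
  by apply: leeD => //; exact: (outer_measure_sigma_subadditive_tail (hausdorffO R n k)).
have PQ N : H (P N.+1) + H (X `&` ~` A) <= H X.
  apply: (@hausdorff_separated k i (t N.+1) (t N.+2)) => // x [Xx] xA.
  split => //=; move: xA => /= /negP; rewrite -leNgt.
  by apply: lt_le_trans; rewrite /t ltrBlDr ltrDl.
have lim : H X + \sum_(N <= j <oo) H (S j.+1) @[N --> \oo] --> H X.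
  by rewrite -[X in _ --> X]adde0; apply: cvgeD => //;
    [exact: fin_num_adde_defr|exact: cvg_cst].
apply: (cvge_ge _ lim); apply: nearW => N.
apply: le_trans (leeD2r _ (XA N)) _.
by rewrite addeAC leeD2r.
Qed.

Lemma hausdorff_borel k : measurable_fun setT
  (id : caratheodory_type (hausdorffO R n k) -> borelN R n).
Proof. by apply: borel_caratheodory => i c; exact: hausdorff_half_space. Qed.

End hausdorff_half_spaces.

(** * Lebesgue measure of boxes *)

Section volume_of_boxes.
Context {R : realType}.
Notation mu := (@lebesgue_measure R).

(** Slicing in the first coordinate: the boxes that meet the slice at height
    [t] cover it, so their cross-sections have total volume at least that of
    the slice, and integrating over [t] gives the claim. *)
Lemma box_cover_volume n (a b : 'I_n -> R) (P : pred nat)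
    (A B : nat -> 'I_n -> R) :
  (forall i, a i <= b i) ->
  (forall x : 'I_n -> R, (forall i, a i <= x i <= b i) ->
    exists2 k, P k & forall i, A k i <= x i <= B k i) ->
  ((\prod_(i < n) (b i - a i))%:E <=
   \sum_(k <oo) if P k then (\prod_(i < n) Num.max 0 (B k i - A k i))%:E
                else 0)%E.
Proof.
elim: n a b P A B => [|n IH] a b P A B ab cov.
  have [|k Pk _] := cov (fun=> 0); first by case.
  rewrite big_ord0 (@nneseriesD1 _ _ k)//; last first.
    by move=> i _; case: ifP; rewrite ?big_ord0.
  rewrite Pk big_ord0 leeDl// nneseries_ge0// => i _ _.
  by case: ifP; rewrite ?big_ord0.
pose tl (f : 'I_n.+1 -> R) j := f (lift ord0 j).
pose c k := \prod_(i < n) Num.max 0 (tl (B k) i - tl (A k) i).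
have c0 k : 0 <= c k by apply: prodr_ge0 => i _; rewrite le_max lexx.
pose I k := `[A k ord0, B k ord0]%classic.
have mI k : measurable (I k) by exact: measurable_itv.
pose h k t := (if P k then (c k)%:E * (\1_(I k) t)%:E else 0)%E.
have h0 k t : (0 <= h k t)%E.
  by rewrite /h; case: ifP => // _; rewrite mule_ge0// lee_fin.
have mh k : measurable_fun `[a ord0, b ord0]%classic (h k).
  rewrite /h; case: (P k); last exact: measurable_cst.
  apply: measurable_funeM.
  by apply/measurable_EFinP; exact: (@measurable_indic _ _ _ _ (I k) (mI k)).
have slice t : t \in `[a ord0, b ord0] ->
    ((\prod_(i < n) (tl b i - tl a i))%:E <= \sum_(k <oo) h k t)%E.
  move=> tab.
  have := IH (tl a) (tl b) (fun k => P k && (A k ord0 <= t <= B k ord0))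
    (fun k => tl (A k)) (fun k => tl (B k)) (fun i => ab _) _.
  move=> /(_ _)/le_trans; apply.
    move=> x xab; have [|k Pk kx] := cov (fun i => oapp x t (unlift ord0 i)).
      by move=> i; case: unliftP => [j ->|->] /=; [exact: xab|exact: tab].
    exists k; first by have := kx ord0; rewrite unlift_none/= Pk.
    by move=> i; have := kx (lift ord0 i); rewrite liftK.
  apply: lee_nneseries => [k _ _|k _].
    by case: ifP => // _; rewrite lee_fin; exact: c0.
  move: (h0 k t); rewrite /h; case: (P k) => //= hk; case: ifP => // tk.
  by rewrite indicE mem_set ?mule1//= in_itv.
rewrite big_ord_recl.
have -> : ((b ord0 - a ord0) * \prod_(i < n) (b (lift ord0 i) - a (lift ord0 i)))%:E
    = (\int[mu]_(t in `[a ord0, b ord0]%classic)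
        (\prod_(i < n) (tl b i - tl a i))%:E)%E.
  rewrite integral_cst//= lebesgue_measure_itv/= lte_fin; case: ltP => [_|ba].
    by rewrite -EFinB -EFinM mulrC.
  by rewrite mule0 (le_anti (introT andP (conj (ab ord0) ba))) subrr mul0r.
apply: (@le_trans _ _
    (\int[mu]_(t in `[a ord0, b ord0]%classic) (\sum_(k <oo) h k t))%E).
  apply: ge0_le_integral => //.
  - by move=> t _; rewrite lee_fin prodr_ge0// => i _; rewrite subr_ge0 ab.
  - by apply: (@ge0_emeasurable_sum _ _ _ _ _ xpredT) => // k _; exact: mh.
rewrite integral_nneseries//; apply: lee_nneseries => [k _ _|k _].
  by apply: integral_ge0.
rewrite /h; case: (P k); last by rewrite integral0.
rewrite ge0_integralZl//; last 2 first.
- by apply/measurable_EFinP; exact: (@measurable_indic _ _ _ _ (I k) (mI k)).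
- by rewrite lee_fin; exact: c0.
rewrite integral_indic//; last exact: mI.
rewrite big_ord_recl [leRHS]EFinM muleC.
rewrite lee_wpmul2r ?lee_fin//.
apply: (@le_trans _ _ (mu (I k))); first by rewrite le_measure ?inE//;
  [apply: measurableI => //|]; exact: mI.
rewrite lebesgue_measure_itv/= lte_fin; case: ltP => [kab|_].
  by rewrite -EFinB lee_fin le_max lexx orbT.
by rewrite lee_fin le_max lexx.
Qed.

Lemma cover_outer_le (T : pointedType) (tau : set T -> \bar R) X :
  tau set0 = 0%E -> (forall A, 0 <= tau A)%E -> (cover_outer tau X <= tau X)%E.
Proof.
move=> tau0 tau_ge0.
apply: ereal_inf_lbound; exists (fun k => if k is 0 then X else set0).
  by move=> x Xx; exists 0.
rewrite (@nneseriesD1 _ _ 0%N)//= eseries0 ?adde0// => i _ /= i0.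
by case: i i0.
Qed.

Lemma lebesgue_ebox_le n (a b : 'rV[R]_n) :
  (forall i, a 0 i <= b 0 i) ->
  (lebesgue_outer (ebox a b) <= (\prod_(i < n) (b 0 i - a 0 i))%:E)%E.
Proof.
move=> ab; apply: le_trans (cover_outer_le _ (box_gauge0 n) (@box_gauge_ge0 _ n)) _.
rewrite /box_gauge ifF; last first.
  apply/negP => /eqP; rewrite -subset0 => /(_ a); apply => i.
  by rewrite lexx ab.
by apply: ereal_inf_lbound; exists (a, b).
Qed.

(** Enclose the nonempty members of a cover in boxes of nearly optimal volume.
    Empty members have gauge [0] and are discarded: no box of volume [0]
    encloses them in dimension [0]. *)
Lemma lebesgue_ebox_ge n (a b : 'rV[R]_n) :
  (forall i, a 0 i <= b 0 i) ->
  ((\prod_(i < n) (b 0 i - a 0 i))%:E <= lebesgue_outer (ebox a b))%E.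
Proof.
move=> ab; apply: le_ereal_inf_tmp => _ [F abF <-].
apply/lee_addgt0Pr => e e0.
apply: le_trans (epsilon_trick xpredT _ (ltW e0)); last first.
  by move=> k; exact: box_gauge_ge0.
pose good k (AB : 'rV[R]_n * 'rV[R]_n) := F k !=set0 ->
  box_gauge (F k) \is a fin_num ->
  F k `<=` ebox AB.1 AB.2 /\
  ((\prod_(i < n) (AB.2 0 i - AB.1 0 i))%:E <=
   box_gauge (F k) + (e / (2 ^ k.+1)%:R)%:E)%E.
have [AB ABP] : {AB : nat -> 'rV[R]_n * 'rV[R]_n & forall k, good k (AB k)}.
  apply: (@choice _ _ good) => k; rewrite /good.
  have [Fk|Fk] := pselect (F k !=set0 /\ box_gauge (F k) \is a fin_num);
    last by exists (0, 0) => H1 H2; exfalso; exact: Fk.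
  case: Fk => [Fk fk].
  have e2 : 0 < e / (2 ^ k.+1)%:R by rewrite divr_gt0// ltr0n expn_gt0.
  move: fk; rewrite /box_gauge ifF; last by move/set0P : Fk => /negbTE.
  move=> fk.
  have [_ [AB /= FAB <-] lt] := lb_ereal_inf_adherent e2 fk.
  by exists AB => _ _; split => //; exact: ltW.
have [[k [Fk Foo]]|Ffin] := pselect (exists k, F k !=set0 /\
    box_gauge (F k) = +oo%E).
  rewrite (nneseries_pinfty (k := k)) ?leey// ?Foo// => j _.
  by rewrite adde_ge0 ?box_gauge_ge0// lee_fin divr_ge0// ltW.
have fin k : F k !=set0 -> box_gauge (F k) \is a fin_num.
  move=> Fk; rewrite ge0_fin_numE ?box_gauge_ge0// ltey; apply/eqP => Foo.
  by apply: Ffin; exists k.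
apply: le_trans (box_cover_volume (P := fun k => F k != set0)
  (A := fun k i => (AB k).1 0 i) (B := fun k i => (AB k).2 0 i) ab _) _.
  move=> x xab; have [|k _ Fkx] := abF (\row_i x i).
    by move=> i; rewrite mxE.
  have Fk : F k !=set0 by exists (\row_i x i).
  exists k; first exact/set0P.
  have [FAB _] := ABP k Fk (fin _ Fk).
  by move=> i; have := FAB _ Fkx i; rewrite mxE.
apply: lee_nneseries => [k _ _|k _].
  case: ifP => // _; rewrite lee_fin prodr_ge0// => i _.
  by rewrite le_max lexx.
case: ifP => Fk; last first.
  by rewrite adde_ge0 ?box_gauge_ge0// lee_fin divr_ge0// ltW.
move/set0P : Fk => Fk; have [FAB] := ABP k Fk (fin _ Fk).
apply: le_trans; rewrite lee_fin le_eqVlt; apply/orP; left; apply/eqP.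
apply: eq_bigr => i _; apply/max_idPr; rewrite subr_ge0.
by have [x /FAB/(_ i)/andP[/le_trans]] := Fk; apply.
Qed.

End volume_of_boxes.

(** * Balls, half-balls and the uniqueness of jumps *)

Section balls.
Context {R : realType} {n : nat}.
Notation V := 'rV[R]_n.
Notation leb := (lebesgueN R n).

Lemma open_eball (x : V) r : open (eball x r).
Proof.
rewrite (_ : eball x r = (fun y => enorm (y - x)) @^-1` [set t | t < r])//.
apply: open_comp => [y _|]; last exact: open_lt.
exact: continuous_enormB.
Qed.

Lemma open_half_ball (x v : V) r : open (half_ball x v r).
Proof.
apply: openI; first exact: open_eball.
rewrite (_ : [set y | _] = (fun y => edot y v) @^-1` [set t | edot x v < t]).
  by apply: open_comp => [y _|]; [exact: continuous_edotl|exact: open_gt].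
by apply/seteqP; split=> y /=; rewrite edotDl edotNl subr_gt0.
Qed.

Lemma open_eball_subset (U : set V) x : open U -> U x ->
  exists2 r, 0 < r & eball x r `<=` U.
Proof.
move=> oU Ux; have /nbhs_normP[r /= r0 rU] : nbhs x U by exact: open_nbhs_nbhs.
exists r => // y yx; apply: rU => /=.
by rewrite (le_lt_trans (mx_norm_le_enorm _))// enormB.
Qed.

Lemma lebesgue_eball_le (x : V) r : 0 <= r ->
  (leb (eball x r) <= ((2 * r) ^+ n)%:E)%E.
Proof.
move=> r0; pose a := \row_i (x 0 i - r); pose b := \row_i (x 0 i + r).
apply: (@le_trans _ _ (leb (ebox a b))).
  apply: le_cover_outer => y yx i; rewrite !mxE.
  have := le_trans (entry_le_enorm (y - x) 0 i) (ltW yx).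
  by rewrite !mxE ler_norml; lra.
apply: le_trans (lebesgue_ebox_le _) _.
  by move=> i; rewrite !mxE; lra.
rewrite lee_fin (eq_bigr (fun=> 2 * r)); first by rewrite prodr_const card_ord.
by move=> i _; rewrite !mxE; lra.
Qed.

Lemma lebesgue_eball_ge (x : V) r : 0 < r ->
  (((2 * (r / n.+1%:R)) ^+ n)%:E <= leb (eball x r))%E.
Proof.
move=> r0; pose e := r / n.+1%:R; have e0 : 0 < e by rewrite divr_gt0.
pose a := \row_i (x 0 i - e); pose b := \row_i (x 0 i + e).
apply: (@le_trans _ _ (leb (ebox a b))); last first.
  apply: le_cover_outer => y yx; rewrite /eball/=.
  apply: le_lt_trans (enorm_le_sum _) _.
  apply: (@le_lt_trans _ _ (\sum_(ij : 'I_1 * 'I_n) e)).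
    apply: ler_sum => -[i j] _ /=; have := yx j; rewrite !mxE (ord1 i).
    by rewrite ler_norml; lra.
  rewrite sumr_const card_prod !card_ord mul1n -mulr_natr /e mulrAC.
  by rewrite ltr_pdivrMr// ltr_pM2l// ltr_nat.
apply: le_trans (lebesgue_ebox_ge _); last by move=> i; rewrite !mxE; lra.
rewrite lee_fin [leRHS](eq_bigr (fun=> 2 * e)).
  by rewrite prodr_const card_ord.
by move=> i _; rewrite !mxE; lra.
Qed.

(** Two half-balls whose normals are not opposite share a ball of comparable
    radius. *)
Lemma half_balls_overlap (v w : V) : enorm v = 1 -> enorm w = 1 -> v <> - w ->
  exists2 q : R, 0 < q & forall x r, 0 < r -> exists z,
    eball z (q * r) `<=` half_ball x v r `&` half_ball x w r.
Proof.
move=> v1 w1 vw; pose c := 1 + edot v w.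
have c0 : 0 < c.
  have : 0 < enorm (v + w) ^+ 2.
    by rewrite exprn_gt0// enorm_gt0//; apply/eqP => /eqP; rewrite addr_eq0 => /eqP.
  rewrite -edotxx edotDl !edotDr !edotxx v1 w1 [edot w v]edotC /c expr1n; lra.
have c2 : c <= 2.
  by have := ler_edot v w; rewrite v1 w1 /c; lra.
(* [x + (r / 4)(v + w)] is at distance [c r / 4] from both hyperplanes *)
exists (c / 8); first by rewrite divr_gt0.
move=> x r r0; exists (x + (r / 4) *: (v + w)) => y; rewrite /eball/=.
set z := y - _ => zr.
have yx : y - x = z + (r / 4) *: (v + w) by rewrite /z opprD addrA subrK.
have cr : c * r <= 2 * r by rewrite ler_wpM2r// ltW.
have zl : enorm z < r / 4 by apply: lt_le_trans zr _; lra.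
have D (a b : V) : enorm a = 1 -> 1 + edot a b = c -> a + b = v + w ->
    0 < edot (y - x) a.
  move=> a1 abc abvw; rewrite yx edotDl edotZl -abvw edotDl edotxx a1 edotC.
  rewrite expr1n [edot b a]edotC abc.
  have := ler_norm_edot a z; rewrite a1 mul1r => /ler_normlP[+ _].
  have cr0 : 0 < c * r by rewrite mulr_gt0.
  move: zr; lra.
have Y : enorm (y - x) < r.
  rewrite yx; apply: le_lt_trans (ler_enormD _ _) _.
  rewrite enormZ gtr0_norm; last by rewrite divr_gt0.
  have := ler_enormD v w; rewrite v1 w1 => vw2.
  have : r / 4 * enorm (v + w) <= r / 4 * (1 + 1).
    by rewrite ler_wpM2l// divr_ge0// ltW.
  by move: zl; lra.
split; split => //=; [exact: (D v w)|].
by apply: (D w v) => //; [rewrite edotC|rewrite addrC].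
Qed.

End balls.

Section uniqueness_of_jumps.
Context {R : realType} {n m : nat}.
Notation V := 'rV[R]_n.
Notation leb := (lebesgueN R n).
Notation LT := (caratheodory_type (lebesgueO R n)).

(** If [a] and [a'] were different, then on the common ball of the two
    half-balls the sum of [|u - a|] and [|u - a'|] would be at least their
    distance, so that not both averages could vanish in the limit. *)
Lemma half_ball_limit_unique (Om : set V) (u : V -> 'rV[R]_m) x a a' (v w : V) :
  open Om -> Om x ->
  (forall i j, measurable_fun (Om : set LT) (fun y => u y i j)) ->
  enorm v = 1 -> enorm w = 1 -> v <> - w ->
  average (half_ball x v r) (fun y => enorm (u y - a)) @[r --> 0^'+] --> 0%E ->
  average (half_ball x w r) (fun y => enorm (u y - a')) @[r --> 0^'+] --> 0%E ->
  a = a'.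
Proof.
move=> oOm Omx mu v1 w1 vw av aw.
have [//|aa'] := eqVneq a a'; exfalso.
have d0 : 0 < enorm (a - a') by rewrite enorm_gt0// subr_eq0.
set d := enorm (a - a') in d0.
have [q q0 qP] := half_balls_overlap v1 w1 vw.
have [rho rho0 rhoOm] := open_eball_subset oOm Omx.
pose K := d * (q / n.+1%:R) ^+ n.
have K0 : 0 < K by rewrite mulr_gt0// exprn_gt0// divr_gt0.
have key r : 0 < r < rho ->
    (K%:E <= average (half_ball x v r) (fun y => enorm (u y - a)) +
       average (half_ball x w r) (fun y => enorm (u y - a')))%E.
  move=> /andP[r0 rrho]; have [z zB] := qP x r r0; pose B := eball z (q * r).
  have qr0 : 0 < q * r by rewrite mulr_gt0.
  have mB : measurable (B : set LT) by apply: lebesgue_open; exact: open_eball.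
  have mH e : measurable (half_ball x e r : set LT).
    by apply: lebesgue_open; exact: open_half_ball.
  have HOm e : half_ball x e r `<=` Om.
    by move=> y [yr _]; apply: rhoOm; exact: lt_trans yr _.
  have mOm : measurable (Om : set LT) by exact: lebesgue_open.
  have me c : measurable_fun (Om : set LT) (fun y => (enorm (u y - c))%:E).
    apply/measurable_EFinP.
    exact: (measurable_continuous mu (@continuous_enormB _ _ _ c)).
  have r2 : 0 < (2 * r) ^+ n by rewrite exprn_gt0// mulr_gt0.
  have avge e c : B `<=` half_ball x e r ->
      (((2 * r) ^+ n)^-1%:E * \int[leb]_(y in B) (enorm (u y - c))%:E <=
       average (half_ball x e r) (fun y => enorm (u y - c)))%E.
    move=> Be; have Hle : (leb (half_ball x e r) <= ((2 * r) ^+ n)%:E)%E.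
      apply: le_trans (lebesgue_eball_le x (ltW r0)).
      by apply: le_cover_outer => y [].
    have Hfin : leb (half_ball x e r) \is a fin_num.
      by rewrite ge0_fin_numE// (le_lt_trans Hle)// ltry.
    have Hpos : 0 < fine (leb (half_ball x e r)).
      rewrite -lte_fin fineK//; apply: (@lt_le_trans _ _ (leb B)).
        apply: lt_le_trans (lebesgue_eball_ge z qr0).
        by rewrite lte_fin exprn_gt0// mulr_gt0// divr_gt0.
      exact: le_cover_outer.
    rewrite /average; apply: lee_pmul.
    - by rewrite lee_fin invr_ge0 ltW.
    - by apply: integral_ge0 => y _; rewrite lee_fin enorm_ge0.
    - by rewrite lee_fin lef_pV2// -lee_fin fineK.
    - apply: ge0_subset_integral => //.
        by apply: measurable_funS (me c) => //; exact: HOm.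
      by move=> y _; rewrite lee_fin enorm_ge0.
  apply: le_trans (leeD (avge v a (fun y => fst \o zB y))
    (avge w a' (fun y => snd \o zB y))).
  rewrite -ge0_muleDr; last 2 first.
  - by apply: integral_ge0 => y _; rewrite lee_fin enorm_ge0.
  - by apply: integral_ge0 => y _; rewrite lee_fin enorm_ge0.
  have BOm : B `<=` Om by move=> y /zB[/HOm].
  rewrite -ge0_integralD//; last 4 first.
  - by move=> y _; rewrite lee_fin enorm_ge0.
  - exact: measurable_funS (me a).
  - by move=> y _; rewrite lee_fin enorm_ge0.
  - exact: measurable_funS (me a').
  rewrite lee_pdivlMl//.
  apply: (@le_trans _ _ (\int[leb]_(y in B) d%:E)%E).
    rewrite integral_cst//.
    apply: le_trans (lee_wpmul2l _ (lebesgue_eball_ge z qr0)); last first.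
      by rewrite lee_fin ltW.
    rewrite -!EFinM lee_fin /K mulrCA ler_wpM2l ?(ltW d0)// -exprMn.
    by rewrite le_eqVlt; apply/orP; left; apply/eqP; congr (_ ^+ _); ring.
  apply: ge0_le_integral => //.
  - by move=> y _; rewrite lee_fin ltW.
  - by apply: emeasurable_funD; exact: measurable_funS (me _).
  move=> y _; rewrite -EFinD lee_fin /d.
  rewrite (_ : a - a' = (u y - a') - (u y - a)); last first.
    by apply/rowP => i; rewrite !mxE; ring.
  by rewrite addrC (le_trans (ler_enormD _ _))// enormN.
have lim0 : (average (half_ball x v r) (fun y => enorm (u y - a)) +
    average (half_ball x w r) (fun y => enorm (u y - a')))%E @[r --> 0^'+] --> 0%E.
  by rewrite -[X in _ --> X]adde0; apply: cvgeD.
have : (K%:E <= 0)%E.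
  apply: (cvge_ge _ lim0).
  by apply: filterS2 (nbhs_right_gt 0) (nbhs_right_lt rho0) => r r0 rrho;
    apply: key; rewrite r0.
by rewrite lee_fin leNgt K0.
Qed.

Lemma approx_jump_unique (Om : set V) (u : V -> 'rV[R]_m) x a b v a' b' v' :
  open Om -> Om x ->
  (forall i j, measurable_fun (Om : set LT) (fun y => u y i j)) ->
  approx_jump u x a b v -> approx_jump u x a' b' v' ->
  (v = v' /\ a - b = a' - b') \/ (v = - v' /\ a - b = - (a' - b')).
Proof.
move=> oOm Omx mu [ab v1 va vb] [ab' v'1 va' vb'].
have U := half_ball_limit_unique oOm Omx mu.
have N1 : enorm (- v) = 1 by rewrite enormN.
have N'1 : enorm (- v') = 1 by rewrite enormN.
have [vv'|vv'] := eqVneq v (- v').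
  right; split => //; rewrite opprB.
  have v0 : v <> - v.
    move=> vN; have : v *+ 2 = 0 by rewrite mulr2n {1}vN addNr.
    move/eqP; rewrite -scaler_nat scaler_eq0 pnatr_eq0/= => /eqP v0.
    by move: v1; rewrite v0 enorm0 => /eqP; rewrite eq_sym oner_eq0.
  by rewrite (U a b' v (- v'))// -?vv'// (U b a' (- v) v')// vv' opprK// => vN;
    apply: v0; rewrite vv' opprK.
have [vv|nvv] := eqVneq v v'.
  have v0 : v <> - v by move=> vN; move/eqP: vv'; apply; rewrite -vv.
  left; split => //; rewrite (U a a' v v')//; last by rewrite -vv.
  by rewrite (U b b' (- v) (- v'))// -vv opprK => /esym.
exfalso; move/eqP : ab'; apply.
have vv1 := elimN eqP vv'; have vv2 := elimN eqP nvv.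
rewrite -(U a a' v v')//; apply: (U a b' v (- v')) => //.
by rewrite opprK.
Qed.

End uniqueness_of_jumps.

(** * Hausdorff measures under Lipschitz maps *)

Section euclidean_lipschitz_maps.
Context {R : realType} {n : nat}.
Notation V := 'rV[R]_n.

Definition elipschitz (L : R) (f : V -> V) :=
  forall x y, enorm (f x - f y) <= L * enorm (x - y).

Lemma enorm_lipschitz_continuous (L : R) (h : V -> R) :
  (forall x y, `|h x - h y| <= L * enorm (x - y)) -> continuous h.
Proof.
move=> hL x; apply/(@cvgrPdist_lt _ _ _ (nbhs x)) => e e0.
have L1 : 0 < `|L| + 1 by rewrite ltr_wpDl.
have /(@cvgrPdist_lt _ _ _ (nbhs x))/(_ (e / (`|L| + 1))) :=
  @continuous_enormB _ _ _ x x.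
rewrite divr_gt0// => /(_ isT); apply: filterS => y.
rewrite subrr enorm0 sub0r normrN ger0_norm ?enorm_ge0// => yx.
apply: le_lt_trans (hL x y) _; rewrite enormB.
apply: (@le_lt_trans _ _ ((`|L| + 1) * enorm (y - x))).
  by rewrite ler_wpM2r ?enorm_ge0// (le_trans (ler_norm _))// lerDl.
by rewrite mulrC -ltr_pdivlMr.
Qed.

Lemma elipschitz_measurable L f : elipschitz L f ->
  measurable_fun setT (f : borelN R n -> borelN R n).
Proof.
move=> fL; apply/measurable_borelP => i j; apply: borel_continuous.
apply: (@enorm_lipschitz_continuous L) => x y.
by apply: le_trans (fL x y); have := entry_le_enorm (f x - f y) i j; rewrite !mxE.
Qed.

End euclidean_lipschitz_maps.

Section hausdorff_lipschitz.
Context {R : realType} {n : nat}.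
Notation V := 'rV[R]_n.
Local Open Scope ereal_scope.

Lemma ediam_image L (f : V -> V) (F : set V) : (0 <= L)%R -> elipschitz L f ->
  ediam (f @` F) <= L%:E * ediam F.
Proof.
move=> L0 fL; apply: ge_ereal_sup => _ [[_ _] [/= [x Fx <-] [y Fy <-]] <-].
apply: (@le_trans _ _ (L%:E * (enorm (x - y))%:E)).
  by rewrite -EFinM lee_fin.
by rewrite lee_wpmul2l ?lee_fin// ediam_ubound.
Qed.

Lemma hausdorff_lipschitz k L (f : V -> V) (X : set V) :
  (0 < L)%R -> elipschitz L f ->
  hausdorff_outer k (f @` X) <= (L ^+ k)%:E * hausdorff_outer k X.
Proof.
move=> L0 fL; apply: ge_ereal_sup => _ [d /= d0 <-].
have Lk0 : (0 < L ^+ k)%R by rewrite exprn_gt0.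
have dL0 : (0 < d / L)%R by rewrite divr_gt0.
apply: (@le_trans _ _
    ((L ^+ k)%:E * cover_outer (@hausdorff_gauge R n k (d / L)) X)); last first.
  by rewrite lee_wpmul2l ?lee_fin ?(ltW Lk0)// hausdorff_ubound.
rewrite -lee_pdivrMl//; apply: le_ereal_inf_tmp => _ [F XF <-].
rewrite lee_pdivrMl// -nneseriesZl; last by move=> *; exact: hausdorff_gauge_ge0.
apply: (@le_trans _ _ (\sum_(j <oo) hausdorff_gauge k d (f @` F j))).
  apply: ereal_inf_lbound; exists (fun j => f @` F j) => // _ [x Xx <-].
  by have [j _ Fx] := XF _ Xx; exists j => //; exists x.
apply: lee_nneseries => [i _ _|j _]; first exact: hausdorff_gauge_ge0.
rewrite /hausdorff_gauge.
have [->|F0] := eqVneq (F j) set0; first by rewrite image_set0 eqxx mule0.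
have fF0 : f @` F j != set0.
  by move/set0P : F0 => [x Fx]; apply/set0P; exists (f x); exists x.
rewrite (negbTE fF0); case: (leP (ediam (F j))) => [Fd|_]; last first.
  by rewrite gt0_muley ?leey// lte_fin.
have fFd : ediam (f @` F j) <= L%:E * ediam (F j).
  by apply: ediam_image => //; exact: ltW.
have fd : ediam (f @` F j) <= d%:E.
  apply: le_trans fFd _; rewrite -lee_pdivlMl//.
  by rewrite -EFinM mulrC.
rewrite fd -EFinM lee_fin mulrCA ler_wpM2l ?ball_volume_ge0//.
have e0 : 0 <= ediam (F j) by apply: ediam_ge0; exact/set0P.
have fe0 : 0 <= ediam (f @` F j) by apply: ediam_ge0; exact/set0P.
have fin1 : ediam (F j) \is a fin_num by rewrite ge0_fin_numE// (le_lt_trans Fd)// ltry.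
have fin2 : ediam (f @` F j) \is a fin_num.
  by rewrite ge0_fin_numE// (le_lt_trans fd)// ltry.
rewrite -exprMn lerXn2r ?nnegrE ?mulr_ge0 ?(ltW L0) ?divr_ge0 ?fine_ge0//.
by rewrite mulrA ler_wpM2r ?invr_ge0// -lee_fin EFinM !fineK.
Qed.

(** The push-forward of the Hausdorff measure under [f] dominates it up to the
    factor [L ^ k], because [B = f (f^-1 B)]. Both are measures on the Borel
    sets, the sigma-algebra along which continuous maps pull back. *)
Lemma ge0_integral_lipschitz_le k L (f : V -> V) (D : set V) (G : V -> \bar R) :
  (0 < L)%R -> elipschitz L f -> (forall y, exists x, f x = y) ->
  measurable (D : set (borelN R n)) ->
  measurable_fun setT (G : borelN R n -> \bar R) -> (forall x, 0 <= G x) ->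
  \int[hausdorff R n k]_(y in D) G y <=
  (L ^+ k)%:E * \int[hausdorff R n k]_(x in f @^-1` D) G (f x).
Proof.
move=> L0 fL fsurj mD mG G0.
pose H := hausdorff R n k.
pose i := id : caratheodory_type (hausdorffO R n k) -> borelN R n.
have mi : measurable_fun setT i := @hausdorff_borel R n k.
pose f' := f : caratheodory_type (hausdorffO R n k) -> borelN R n.
have mf' : measurable_fun setT f'.
  exact: (measurableT_comp (elipschitz_measurable fL) mi).
pose m1 := measure_function_pushforward__canonical__measure_function_Measure H mi.
pose m2 := measure_function_pushforward__canonical__measure_function_Measure H mf'.
have Lk0 : (0 <= L ^+ k)%R by rewrite exprn_ge0// ltW.
have m12 (S : set (borelN R n)) : measurable S -> m1 S <= mscale (NngNum Lk0) m2 S.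
  move=> mS; rewrite /mscale/=.
  rewrite (_ : m1 S = hausdorff_outer k (f @` (f @^-1` S))).
    exact: hausdorff_lipschitz.
  rewrite (_ : f @` _ = S)//; apply/seteqP; split => [_ [x ? <-]//|y Sy].
  by have [x xy] := fsurj y; exists x => //=; rewrite /preimage/= xy.
have GD : {in D, forall y, 0 <= G y} by move=> y _; exact: G0.
have mGD : measurable_fun (D : set (borelN R n)) (G : borelN R n -> \bar R).
  exact: (measurable_funS measurableT _ mG).
have := ge0_le_measure_integral m12 mD G0 mG.
rewrite ge0_integral_mscale//=.
have := ge0_integral_pushforward mi H mD mGD GD.
have := ge0_integral_pushforward mf' H mD mGD GD.
by rewrite /m1 /m2/= => -> ->.
Qed.

End hausdorff_lipschitz.

(** * Lipschitz functions with bounded directional derivative *)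

Section translation_invariance.
Context {R : realType} {n : nat}.
Notation V := 'rV[R]_n.
Notation leb := (lebesgueN R n).
Local Open Scope ereal_scope.

Lemma box_gauge_shift (v : V) (A : set V) :
  box_gauge ((fun x => x + v)%R @^-1` A) <= box_gauge A.
Proof.
rewrite {1}/box_gauge; have [_|/set0P[x Ax]] := eqVneq (_ @^-1` A) set0.
  exact: box_gauge_ge0.
rewrite /box_gauge ifF; last by apply/negP => /eqP A0; move: Ax; rewrite A0.
apply: le_ereal_inf_tmp => _ [[a b] /= Aab <-].
apply: ereal_inf_lbound; exists (a - v, b - v)%R => /=.
  move=> y /Aab yab i; have := yab i; rewrite !mxE.
  by rewrite lerBlDr lerBrDr.
congr EFin; apply: eq_bigr => i _; rewrite !mxE; ring.
Qed.

Lemma lebesgue_outer_shift (v : V) (A : set V) :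
  lebesgue_outer ((fun x => x + v)%R @^-1` A) <= lebesgue_outer A.
Proof.
apply: le_ereal_inf_tmp => _ [F AF <-].
apply: (@le_trans _ _
    (\sum_(k <oo) box_gauge ((fun x => x + v)%R @^-1` F k))).
  apply: ereal_inf_lbound; exists (fun k => (fun x => x + v)%R @^-1` F k) => //.
  by move=> x /AF[k _ Fx]; exists k.
apply: lee_nneseries => [i _ _|k _]; first exact: box_gauge_ge0.
exact: box_gauge_shift.
Qed.

Lemma ae_shift (v : V) (P : V -> Prop) :
  {ae leb, forall x, P x} -> {ae leb, forall x, P (x + v)%R}.
Proof.
move=> [N [mN N0 PN]].
have S0 : lebesgue_outer ((fun x => x + v)%R @^-1` N) = 0.
  apply/eqP; rewrite eq_le outer_measure_ge0 andbT.
  by apply: le_trans (lebesgue_outer_shift v N) _; rewrite -N0.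
exists ((fun x => x + v)%R @^-1` N); split => //; last first.
  by move=> x nP; exact: PN.
apply: le_caratheodory_measurable => X.
rewrite (_ : lebesgueO R n (X `&` _) = 0) ?add0e.
  by apply: le_outer_measure => x [].
apply/eqP; rewrite eq_le outer_measure_ge0 andbT -S0.
by apply: le_cover_outer => x [].
Qed.

End translation_invariance.

Section lipschitz_from_derivative.
Context {R : realType} {n : nat}.
Notation V := 'rV[R]_n.
Notation leb := (lebesgueN R n).
Notation LT := (caratheodory_type (lebesgueO R n)).

Lemma lebesgue_continuous_measurable (D : set V) (h : V -> R) : continuous h ->
  measurable_fun (D : set LT) h.
Proof.
move=> ch; apply: (@measurable_funTS _ _ LT R).
exact: (measurableT_comp (borel_continuous ch) (@lebesgue_borel R n)).
Qed.

Lemma ler_dist_max0 (a b : R) : `|Num.max 0 a - Num.max 0 b| <= `|a - b|.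
Proof.
have := ler_norm (a - b); have := ler_norm (- (a - b)); rewrite normrN.
case: (leP 0 a) => a0; case: (leP 0 b) => b0 ab ba; rewrite ler_norml;
  apply/andP; split; lra.
Qed.

Variables (phi : V -> R) (L : R).
Hypothesis phiL : forall x y, `|phi x - phi y| <= L * enorm (x - y).

Let phi_shift_continuous (w : V) : continuous (fun y : V => phi (y + w)).
Proof.
apply: (@enorm_lipschitz_continuous _ _ L) => x y.
by apply: le_trans (phiL _ _) _; rewrite opprD addrACA subrr addr0.
Qed.

Section average_over_a_ball.
Variable rho : R.
Hypothesis rho0 : 0 < rho.
Let Q : set LT := eball (0 : V) rho.

Lemma measurable_eball0 : measurable Q.
Proof. exact/lebesgue_open/open_eball. Qed.

Lemma lebesgue_eball0_fin : (leb Q < +oo)%E.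
Proof. by apply: le_lt_trans (lebesgue_eball_le _ (ltW rho0)) _; rewrite ltry. Qed.

Lemma lebesgue_eball0_gt0 : 0 < fine (leb Q).
Proof.
rewrite fine_gt0// lebesgue_eball0_fin andbT.
apply: lt_le_trans (lebesgue_eball_ge _ rho0).
by rewrite lte_fin exprn_gt0// mulr_gt0// divr_gt0.
Qed.

Lemma continuous_bounded_integrable (h : V -> R) M : continuous h ->
  (forall y, Q y -> `|h y| <= M) -> leb.-integrable Q (EFin \o h).
Proof.
move=> ch hM; apply: measurable_bounded_integrable; rewrite ?lebesgue_eball0_fin//;
  [exact: measurable_eball0| |].
  exact: lebesgue_continuous_measurable.
by exists M; split; rewrite ?num_real// => x Mx y Qy; exact: le_trans (hM y Qy) (ltW Mx).
Qed.

Let mQ := measurable_eball0.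

Let phi_integrable (w : V) : leb.-integrable Q (EFin \o (fun y => phi (y + w))).
Proof.
apply: (@continuous_bounded_integrable _ (`|phi w| + `|L| * rho)).
  exact: phi_shift_continuous.
move=> y; rewrite /Q /eball/= subr0 => yrho.
rewrite -[phi _](subrK (phi w)) addrC (le_trans (ler_normD _ _))// lerD2l.
apply: le_trans (phiL _ _) _; rewrite addrK.
apply: (@le_trans _ _ (`|L| * enorm y)).
  by rewrite ler_wpM2r ?enorm_ge0// ler_norm.
by rewrite ler_wpM2l// ltW.
Qed.

Definition ball_integral (w : V) : R := (\int[leb]_(y in Q) phi (y + w)).

Let F := ball_integral.

Lemma ball_integralB w w' :
  ball_integral w - ball_integral w' =
  \int[leb]_(y in Q) (phi (y + w) - phi (y + w')).
Proof. by rewrite RintegralB//; exact: phi_integrable. Qed.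

Lemma increment_integrable w w' :
  leb.-integrable Q (EFin \o (fun y => phi (y + w) - phi (y + w'))).
Proof.
by apply: (@integrableB _ _ _ leb Q mQ (EFin \o (fun y => phi (y + w)))
  (EFin \o (fun y => phi (y + w')))); exact: phi_integrable.
Qed.

Lemma ball_integral_lipschitz w w' :
  `|ball_integral w - ball_integral w'| <= L * enorm (w - w') * fine (leb Q).
Proof.
rewrite ball_integralB.
apply: le_trans (le_normr_Rintegral mQ (increment_integrable w w')) _.
rewrite -Rintegral_cst//; apply: le_Rintegral => //.
- exact: (integrable_norm (increment_integrable w w')).
- apply: (@continuous_bounded_integrable (fun=> _) `|L * enorm (w - w')|) => //.
  exact: cst_continuous.
- move=> y _; apply: le_trans (phiL _ _) _.
  by rewrite opprD addrACA subrr add0r.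
Qed.

(** Where the directional derivative is at most [c], the positive parts of the
    excess of the difference quotients tend to [0]; dominated convergence
    applies to them. *)
Lemma limit_of_quotients (v w : V) (c e : R) (h : nat -> R) :
  0 < e -> (forall k, 0 < h k) -> h @ \oo --> 0 ->
  {ae leb, forall z, forall eta, 0 < eta -> exists2 r, 0 < r &
    forall t, 0 < t < r -> phi (z + t *: v) - phi z <= (c + eta) * t} ->
  ~ (forall k, (c + e *+ 2) * fine (leb Q) * h k <= F (w + h k *: v) - F w).
Proof.
move=> e0 h0 hlim ae_c Fh.
pose q k (y : V) := Num.max 0
  ((phi (y + (w + h k *: v)) - phi (y + w)) / h k - (c + e)).
have cq k : continuous (q k).
  apply: (@enorm_lipschitz_continuous _ _ (`|L| * 2 / h k)) => x y.
  rewrite /q; set A := phi (x + _) - _; set B := phi (y + _) - _.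
  apply: (@le_trans _ _ `|A / h k - B / h k|).
    apply: le_trans (ler_dist_max0 _ _) _.
    by rewrite opprB addrA subrK.
  rewrite -mulrBl normrM [ `|(h k)^-1|]gtr0_norm ?invr_gt0// mulrAC.
  rewrite ler_wpM2r ?invr_ge0 ?(ltW (h0 k))//.
  rewrite (_ : A - B = (phi (x + (w + h k *: v)) - phi (y + (w + h k *: v))) -
    (phi (x + w) - phi (y + w))); last by rewrite /A /B; ring.
  apply: le_trans (ler_normB _ _) _.
  have P z : `|phi (x + z) - phi (y + z)| <= `|L| * enorm (x - y).
    apply: le_trans (phiL _ _) _; rewrite opprD addrACA subrr addr0.
    by rewrite ler_wpM2r ?enorm_ge0// ler_norm.
  by have := P w; have := P (w + h k *: v); lra.
pose M := `|L| * enorm v + `|c + e|.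
have M0 : 0 <= M by rewrite addr_ge0// mulr_ge0// enorm_ge0.
have qM k y : `|q k y| <= M.
  rewrite ger0_norm ?le_max ?lexx// ge_max M0/= lerBlDr.
  rewrite ler_pdivrMr// (le_trans (ler_norm _))//.
  apply: le_trans (phiL _ _) _; rewrite opprD addrACA subrr add0r addrAC subrr add0r.
  rewrite enormZ gtr0_norm// [h k * _]mulrC mulrA ler_wpM2r ?(ltW (h0 k))//.
  apply: (@le_trans _ _ (`|L| * enorm v)).
    by rewrite ler_wpM2r ?enorm_ge0// ler_norm.
  by rewrite /M -addrA lerDl -lerBlDr sub0r -normrN ler_norm.
have iM : leb.-integrable Q (EFin \o (fun=> M)).
  apply: (@continuous_bounded_integrable _ M); first exact: cst_continuous.
  by move=> y _; rewrite ger0_norm.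
have iq k : leb.-integrable Q (EFin \o q k).
  by apply: (@continuous_bounded_integrable _ M).
have qlim : {ae leb, forall y, Q y -> (EFin \o q k) y @[k --> \oo] --> cst 0%E y}.
  apply: ae_imply (ae_shift w ae_c) => y yc _.
  have [r r0 rP] := yc e e0.
  apply: cvg_near_cst.
  have : \forall k \near \oo, `|h k| < r.
    by have /cvgr0Pnorm_lt := hlim; apply.
  apply: filterS => k; rewrite gtr0_norm// => hr /=.
  congr EFin; apply/max_idPl; rewrite subr_le0 ler_pdivrMr//.
  by rewrite addrA; apply: rP; rewrite h0.
have mq k : measurable_fun Q (EFin \o q k).
  by apply/measurable_EFinP; exact: lebesgue_continuous_measurable.
have qbound : {ae leb, forall y k, Q y -> (`|(EFin \o q k) y| <= (EFin \o cst M) y)%E}.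
  by apply: aeW => y k _; rewrite /= lee_fin.
have [_ _] := dominated_convergence mQ mq (measurable_cst _) qlim iM qbound.
rewrite integral0 => lim0.
have lower k : e * fine (leb Q) <= \int[leb]_(y in Q) q k y.
  have hk := h0 k; pose g y := phi (y + (w + h k *: v)) - phi (y + w).
  have ig : leb.-integrable Q (EFin \o g) by exact: increment_integrable.
  have igh : leb.-integrable Q (EFin \o (fun y => g y / h k)).
    exact: (integrableZr mQ (h k)^-1 ig).
  have icst : leb.-integrable Q (EFin \o (fun=> c + e)).
    by apply: (@continuous_bounded_integrable _ `|c + e|) => //;
      exact: cst_continuous.
  apply: (@le_trans _ _ (\int[leb]_(y in Q) (g y / h k - (c + e)))).
    rewrite RintegralB// RintegralZr// Rintegral_cst//.
    have := Fh k; rewrite ball_integralB -/g -ler_pdivlMr// mulr2n; lra.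
  apply: le_Rintegral => //.
    by apply: (@integrableB _ _ _ leb Q mQ (EFin \o (fun y => g y / h k))
      (EFin \o (fun=> c + e))).
  by move=> y _; rewrite le_max lexx orbT.
have : ((e * fine (leb Q))%:E <= 0)%E.
  apply: (cvge_ge _ lim0); apply: nearW => k /=.
  apply: le_trans (_ : (\int[leb]_(y in Q) q k y)%:E <= _)%E.
    by rewrite lee_fin.
  by rewrite /Rintegral fineK//; exact: (integrable_fin_num mQ (iq k)).
by rewrite lee_fin leNgt mulr_gt0// lebesgue_eball0_gt0.
Qed.

End average_over_a_ball.

(** If [phi (x + v) - phi x] exceeded [c], then so would the increment of the
    averages of [phi] over a small ball moving from [x] to [x + v]. Tilting by
    a slope slightly larger than [c], the averages attain a minimum before the
    end point, and there the right difference quotients are too large. *)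
Lemma increment_le_derivative (v x : V) (c : R) :
  {ae leb, forall z, forall eta, 0 < eta -> exists2 r, 0 < r &
    forall t, 0 < t < r -> phi (z + t *: v) - phi z <= (c + eta) * t} ->
  phi (x + v) - phi x <= c.
Proof.
move=> ae_c; rewrite leNgt; apply/negP => cphi.
(* The increment is [c + 4 e]. On a ball of radius [rho] it stays above
   [c + 3 e], the averages are tilted by the slope [c + 2 e], and the
   derivative allows at most [c + e]. *)
pose e := (phi (x + v) - phi x - c) / 4.
have e0 : 0 < e by rewrite divr_gt0// subr_gt0.
pose rho := e / (2 * (`|L| + 1)).
have rho0 : 0 < rho by rewrite divr_gt0// mulr_gt0// ltr_wpDl.
pose Q : set LT := eball (0 : V) rho.
pose q := fine (leb Q).
have q0 : 0 < q by exact: lebesgue_eball0_gt0.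
pose F := ball_integral rho.
have F1 : (c + e *+ 3) * q <= F (x + v) - F x.
  rewrite ball_integralB// -Rintegral_cst//; last exact: measurable_eball0.
  apply: le_Rintegral; first exact: measurable_eball0.
  - by apply: (@continuous_bounded_integrable _ _ _ `|c + e *+ 3|) => //;
      exact: cst_continuous.
  - exact: increment_integrable.
  move=> y; rewrite /Q /eball/= subr0 => yrho.
  have Le : `|L| * enorm y <= e / 2.
    apply: (@le_trans _ _ ((`|L| + 1) * rho)).
      by apply: ler_pM; rewrite ?enorm_ge0// ?lerDl// ltW.
    have L1 : `|L| + 1 != 0 by rewrite gt_eqF// ltr_wpDl.
    by rewrite le_eqVlt; apply/orP; left; apply/eqP; rewrite /rho; field.
  have A z : `|phi (y + z) - phi z| <= e / 2.
    apply: le_trans (phiL _ _) _; rewrite addrK; apply: le_trans _ Le.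
    by rewrite ler_wpM2r ?enorm_ge0// ler_norm.
  have := A x; have := A (x + v); rewrite !ler_norml => /andP[A1 A2] /andP[A3 A4].
  rewrite mulrSr mulr2n; move: A1 A2 A3 A4; rewrite /e; lra.
pose G t := F (x + t *: v) - (c + e *+ 2) * q * t.
have cG : {within `[0, 1], continuous G}.
  apply: continuous_subspaceT => t.
  apply/(@cvgrPdist_le _ _ _ (nbhs t)) => d d0.
  pose K := `|L| * enorm v * q + `|(c + e *+ 2) * q| + 1.
  have K0 : 0 < K.
    by rewrite ltr_wpDl// addr_ge0// !mulr_ge0// ?enorm_ge0// ltW.
  have : \forall t' \near t, `|t - t'| < d / K.
    by apply/nbhs_normP; exists (d / K) => //=; rewrite divr_gt0.
  apply: filterS => t' tt'; rewrite /G.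
  rewrite (_ : _ - _ = (F (x + t *: v) - F (x + t' *: v)) -
    (c + e *+ 2) * q * (t - t')); last by ring.
  apply: le_trans (ler_normB _ _) _.
  apply: le_trans (lerD (ball_integral_lipschitz rho0 _ _) (lexx _)) _.
  rewrite opprD addrACA subrr add0r -scalerBl enormZ normrM.
  apply: (@le_trans _ _ (K * `|t - t'|)).
    rewrite [leRHS]mulrDl [X in _ <= X + _]mulrDl mul1r.
    rewrite -[leLHS]addr0 lerD//= lerD2r.
    rewrite [leLHS](_ : _ = L * enorm v * q * `|t - t'|); last first.
      by rewrite /q /Q; ring.
    rewrite ler_wpM2r// ler_wpM2r ?(ltW q0)//.
    by rewrite ler_wpM2r ?enorm_ge0// ler_norm.
  by rewrite mulrC -ler_pdivlMr// ltW.
have G01 : G 0 < G 1.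
  rewrite /G scale0r scale1r !mulr0 mulr1 subr0 addr0 ltrBrDr.
  rewrite -ltrBrDl; apply: lt_le_trans F1; rewrite ltr_pM2r// ltrD2l.
  by rewrite ltr_pMn2l.
have [t0 t01 Gmin] := EVT_min ler01 cG.
have t1 : t0 < 1.
  rewrite lt_neqAle; move: (t01); rewrite in_itv/= => /andP[_ ->]; rewrite andbT.
  apply/eqP => t01e; have := Gmin 0; rewrite in_itv/= lexx ler01 => /(_ isT).
  by rewrite t01e leNgt G01.
pose h k := (1 - t0) / k.+1%:R.
have h0 k : 0 < h k by rewrite divr_gt0// subr_gt0.
have hlim : h @ \oo --> 0.
  rewrite -[X in _ --> X](mulr0 (1 - t0)).
  apply: cvgM; first exact: cvg_cst.
  exact: cvg_harmonic.
apply: (@limit_of_quotients rho rho0 v (x + t0 *: v) c e h e0 h0 hlim ae_c).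
move=> k; have /Gmin : t0 + h k \in `[0, 1].
  move: t01; rewrite !in_itv/= => /andP[t00 _]; apply/andP; split.
    by rewrite addr_ge0// ltW.
  rewrite -lerBrDl /h ler_pdivrMr// ler_peMr ?subr_ge0 ?(ltW t1)//.
  by rewrite ler1n.
rewrite /G /F /q /Q scalerDl [x + (_ + _)]addrA mulrDr; lra.
Qed.

End lipschitz_from_derivative.

(** * Perturbations of the identity *)

Section near_identity_maps.
Context {R : realType} {n : nat}.
Notation V := 'rV[R]_n.
Notation leb := (lebesgueN R n).

Lemma lipschitz_elipschitz (f : V -> V) : lipschitz f ->
  exists2 L : R, 0 <= L & elipschitz L f.
Proof.
move=> [M [_ fM]]; exists ((1 * n)%:R * (`|M| + 1)).
  by rewrite mulr_ge0// addr_ge0.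
move=> x y; apply: le_trans (enorm_le_mx_norm _) _.
rewrite -mulrA ler_wpM2l//.
have MM : M < `|M| + 1 by rewrite (le_lt_trans (ler_norm M))// ltrDl.
apply: le_trans (fM _ MM (x, y) _) _ => //=.
by rewrite ler_wpM2l ?addr_ge0// mx_norm_le_enorm.
Qed.

(** Testing with [w = (f x - x) - (f y - y)] reduces the claim to the scalar
    function [z |-> (f z - z) . w], whose increment from [y] to [x] is
    [|w|^2]. *)
Lemma near_identity_lipschitz (f : V -> V) (c : R) : 0 <= c ->
  lipschitz f ->
  {ae leb, forall x, differentiable f (x : V)} ->
  {ae leb, forall x, enorm ('J f (x : V) - 1%:M) <= c} ->
  elipschitz c (fun x => f x - x).
Proof.
move=> c0 /lipschitz_elipschitz[L L0 fL] fdiff fJ x y.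
set w := (f x - x) - (f y - y).
have [->|wn0] := eqVneq (enorm w) 0; first by rewrite mulr_ge0// enorm_ge0.
have w0 : 0 < enorm w by rewrite lt0r wn0 enorm_ge0.
pose phi z := edot (f z - z) w; pose v := x - y.
have phiB a b : phi a - phi b = edot ((f a - f b) - (a - b)) w.
  by rewrite /phi -edotNl -edotDl; congr edot; apply/rowP => i; rewrite !mxE; ring.
have phiL a b : `|phi a - phi b| <= ((L + 1) * enorm w) * enorm (a - b).
  rewrite phiB; apply: le_trans (ler_norm_edot _ _) _.
  rewrite mulrAC ler_wpM2r ?enorm_ge0//.
  apply: le_trans (ler_enormD _ _) _; rewrite enormN mulrDl mul1r lerD2r.
  exact: fL.
have ae_c : {ae leb, forall z, forall eta, 0 < eta -> exists2 r, 0 < r &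
    forall t, 0 < t < r -> phi (z + t *: v) - phi z <=
      (c * enorm v * enorm w + eta) * t}.
  apply: ae_imply2 fdiff fJ => z dz Jz eta eta0.
  have dv : (fun h => h^-1 *: ((f \o shift z) (h *: v) - f z)) @ 0^' -->
      v *m 'J f z.
    by rewrite -deriveEjacobian//; exact: (diff_derivable dz).
  (* the factor [1 * n] bounds the Euclidean norm by the sup norm *)
  pose e1 := eta / ((1 * n)%:R * enorm w + 1).
  have nw0 : 0 < (1 * n)%:R * enorm w + 1.
    by rewrite ltr_wpDl// mulr_ge0// enorm_ge0.
  have e10 : 0 < e1 by rewrite divr_gt0.
  have /nbhs_ballP[r /= r0 rP] : \forall h \near (0 : R)^',
      `|v *m 'J f z - h^-1 *: (f (h *: v + z) - f z)| < e1.
    by move/cvgrPdist_lt : dv => /(_ _ e10).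
  exists r => // t /andP[t0 tr].
  have {}rP := rP t _ (lt0r_neq0 t0).
  have /rP tJ : ball 0 r t by rewrite /ball/= sub0r normrN gtr0_norm.
  set q := t^-1 *: _ in tJ.
  have qE : f (z + t *: v) - f z = t *: q.
    by rewrite /q scalerA mulfV ?gt_eqF// scale1r [z + _]addrC.
  rewrite phiB qE [z + _ - z]addrC addKr -scalerBr edotZl mulrC ler_wpM2r ?(ltW t0)//.
  rewrite (_ : q - v = v *m ('J f z - 1%:M) - (v *m 'J f z - q)); last first.
    by rewrite mulmxBr mulmx1; apply/rowP => i; rewrite !mxE; ring.
  apply: le_trans (ler_edot _ _) _.
  apply: (@le_trans _ _ ((c * enorm v + (1 * n)%:R * e1) * enorm w)).
    rewrite ler_wpM2r ?enorm_ge0//; apply: le_trans (ler_enormD _ _) _.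
    rewrite lerD//.
      by apply: le_trans (ler_enorm_mulmx _ _) _; rewrite mulrC ler_wpM2r// enorm_ge0.
    rewrite enormN; apply: le_trans (enorm_le_mx_norm _) _.
    by rewrite ler_wpM2l// ltW.
  rewrite mulrDl lerD2l mulrAC /e1 mulrA ler_pdivrMr// mulrC ler_wpM2l ?(ltW eta0)//.
  by rewrite lerDl.
have := increment_le_derivative phiL y ae_c.
rewrite /v [y + _]addrC subrK phiB (_ : f x - f y - (x - y) = w); last first.
  by apply/rowP => i; rewrite !mxE; ring.
by rewrite edotxx expr2 ler_pM2r.
Qed.

Variables (f : V -> V) (c : R).
Hypotheses (c1 : c < 1) (fc : elipschitz c (fun x => f x - x)).

Lemma near_identity_upper : elipschitz (1 + c) f.
Proof.
move=> x y; rewrite mulrDl mul1r [leRHS]addrC.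
apply: le_trans (lerD (fc x y) (lexx _)).
rewrite -[X in X <= _](_ : enorm ((f x - x) - (f y - y) + (x - y)) = _).
  exact: ler_enormD.
by congr enorm; apply/rowP => i; rewrite !mxE; ring.
Qed.

Lemma near_identity_lower x y : (1 - c) * enorm (x - y) <= enorm (f x - f y).
Proof.
rewrite mulrBl mul1r lerBlDr; apply: le_trans (lerD (lexx _) (fc x y)).
rewrite -[X in X <= _](_ : enorm ((f x - f y) - ((f x - x) - (f y - y))) = _).
  by rewrite (le_trans (ler_enormD _ _))// enormN.
by congr enorm; apply/rowP => i; rewrite !mxE; ring.
Qed.

(** The distance from [f x] to [y] attains its minimum at some [p], and moving
    [p] by the defect [y - f p] multiplies it by at most [c < 1]. *)
Lemma near_identity_surjective y : exists x, f x = y.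
Proof.
have c10 : 0 < 1 - c by rewrite subr_gt0.
pose h x := enorm (f x - y).
(* outside the cube of half-side [rho] the distance exceeds its value at [0] *)
pose rho := (h 0 *+ 2 + 1) / (1 - c).
pose A : set V := [set x | forall i, `[- rho, rho]%classic (x ord0 i)].
have rho0 : 0 <= rho by rewrite divr_ge0 ?(ltW c10)// addr_ge0// mulrn_wge0 ?enorm_ge0.
have A0 : A 0 by move=> i; rewrite mxE /= in_itv/= oppr_le0 rho0.
have cA : compact A.
  by apply: (@rV_compact _ _ (fun=> `[- rho, rho]%classic)) => i; exact: segment_compact.
have ch : continuous h.
  apply: (@enorm_lipschitz_continuous _ _ (1 + c)) => a b.
  apply: le_trans (ler_dist_enorm _ _) _; rewrite opprB addrA subrK.
  exact: near_identity_upper.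
have [p pA pmin] := EVT_min_rV (ex_intro _ 0 A0) cA (continuous_subspaceT ch).
have far x : ~ A x -> h p <= h x.
  move=> nAx; apply: (@le_trans _ _ (h 0)).
    by apply: pmin; rewrite inE.
  have [i xi] : exists i, rho < `|x ord0 i|.
    apply: contrapT => nx; apply: nAx => i; rewrite /= in_itv/= -ler_norml.
    by rewrite leNgt; apply/negP => xi; apply: nx; exists i.
  have rx : rho < enorm x by apply: lt_le_trans xi (entry_le_enorm _ _ _).
  have := near_identity_lower x 0; rewrite subr0 => lo.
  have : (1 - c) * rho < (1 - c) * enorm x by rewrite ltr_pM2l.
  rewrite {1}/rho mulrC divfK ?gt_eqF// => hx.
  have : enorm (f x - f 0) <= h x + h 0.
    rewrite /h [enorm (f 0 - y)]enormB; apply: le_trans (ler_enormD _ _).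
    by rewrite addrA subrK.
  by rewrite mulr2n in hx; lra.
have pall x : h p <= h x.
  have [Ax|nAx] := pselect (A x); last exact: far.
  by apply: pmin; rewrite inE.
exists p; apply/eqP; rewrite -subr_eq0; apply/eqP/enorm_eq0; apply/eqP.
rewrite eq_le enorm_ge0 andbT leNgt; apply/negP => hp0.
pose d := y - f p; have dh : enorm d = h p by rewrite /h enormB.
have : h (p + d) <= c * h p.
  have := fc (p + d) p; rewrite [p + d - p]addrC addKr dh; apply: le_trans.
  by rewrite le_eqVlt; apply/orP; left; apply/eqP; congr enorm;
    apply/rowP => i; rewrite !mxE; ring.
apply/negP; rewrite -ltNge; apply: lt_le_trans (pall _).
by rewrite gtr_pMl.
Qed.

Lemma near_identity_inverse : exists2 g : V -> V,
  cancel f g /\ cancel g f & elipschitz (1 - c)^-1 g.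
Proof.
have c10 : 0 < 1 - c by rewrite subr_gt0.
have [g gK] := choice near_identity_surjective.
exists g; first split => // x.
  apply/eqP; rewrite -subr_eq0; apply/eqP/enorm_eq0/eqP.
  have := near_identity_lower (g (f x)) x; rewrite gK subrr enorm0.
  by rewrite pmulr_rle0// => H; rewrite eq_le H enorm_ge0.
move=> x y; rewrite ler_pdivlMl//.
by have := near_identity_lower (g x) (g y); rewrite !gK.
Qed.

End near_identity_maps.

(** * Vanishing of controlled integrals *)

Section vanishing_integrals.
Local Open Scope ereal_scope.

Lemma ge0_cvge0 (R : realType) (a : nat -> \bar R) :
  (forall j, 0 <= a j) ->
  (forall e : R, (0 < e)%R -> \forall j \near \oo, a j < e%:E) ->
  a @ \oo --> 0.
Proof.
move=> a0 ae; apply/fine_cvgP; split.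
  by apply: filterS (ae 1%R ltr01) => j aj; rewrite ge0_fin_numE// (lt_trans aj)// ltry.
apply/cvgr0Pnorm_lt => e e0; apply: filterS (ae e e0) => j aj.
rewrite ger0_norm ?fine_ge0// -lte_fin fineK//.
by rewrite ge0_fin_numE// (lt_trans aj)// ltry.
Qed.

(** If the integrals of the controls [h j] did not force those of the [F j] to
    vanish, one could select indices along which the integrals of [F j] stay
    away from [0] although those of [h j] are summable. Then [h j] tends to [0]
    almost everywhere along these indices, the sum of the selected [h j]
    provides an integrable bound, and dominated convergence gives a
    contradiction. *)
Lemma controlled_integrals_vanish d (T : measurableType d) (R : realType)
    (mu : {measure set T -> \bar R}) (D : set T) (F h : nat -> T -> R)
    (G : T -> R) (c : R) :
  measurable D ->
  (forall j, measurable_fun D (F j)) -> (forall j, measurable_fun D (h j)) ->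
  (forall j x, D x -> (0 <= F j x)%R) -> (forall j x, D x -> (0 <= h j x)%R) ->
  (0 <= c)%R -> mu.-integrable D (EFin \o G) ->
  (forall j x, D x -> (F j x <= G x + c * h j x)%R) ->
  \int[mu]_(x in D) (h j x)%:E @[j --> \oo] --> 0 ->
  (forall x, D x -> forall e : R, (0 < e)%R -> exists2 d : R, (0 < d)%R &
    forall j, (h j x < d -> F j x < e)%R) ->
  \int[mu]_(x in D) (F j x)%:E @[j --> \oo] --> 0.
Proof.
move=> mD mF mh F0 h0 c0 iG FG hlim ctrl.
have aF0 j : 0 <= \int[mu]_(x in D) (F j x)%:E.
  by apply: integral_ge0 => x Dx; rewrite lee_fin F0.
apply: ge0_cvge0 => // e e0; apply: contrapT => nF.
have sel k : {j | \int[mu]_(x in D) (h j x)%:E < (1 / (2 ^ k.+1)%:R)%:E /\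
    e%:E <= \int[mu]_(x in D) (F j x)%:E}.
  apply: cid; apply: contrapT => nj; apply: nF.
  have p0 : (0 < 1 / (2 ^ k.+1)%:R :> R)%R by rewrite divr_gt0// ltr0n expn_gt0.
  have : \forall j \near \oo, \int[mu]_(x in D) (h j x)%:E < (1 / (2 ^ k.+1)%:R)%:E.
    move/fine_cvgP : hlim => [fin /cvgr0Pnorm_lt/(_ _ p0)].
    apply: filterS2 fin => j fj; rewrite ger0_norm ?fine_ge0//; last first.
      by apply: integral_ge0 => x Dx; rewrite lee_fin h0.
    by rewrite -lte_fin fineK.
  apply: filterS => j hj; rewrite ltNge; apply/negP => Fj; apply: nj.
  by exists j.
pose J k := sval (sel k).
have hJ k : \int[mu]_(x in D) (h (J k) x)%:E < (1 / (2 ^ k.+1)%:R)%:E.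
  by have [] := svalP (sel k).
have FJ k : e%:E <= \int[mu]_(x in D) (F (J k) x)%:E.
  by have [] := svalP (sel k).
pose H x := \sum_(k <oo) (h (J k) x)%:E.
have mhJ k : measurable_fun D (fun x => (h (J k) x)%:E) by exact/measurable_EFinP.
have mH : measurable_fun D H.
  by apply: (@ge0_emeasurable_sum _ _ _ _ _ xpredT) => // k x Dx _; rewrite lee_fin h0.
have H0 x : D x -> 0 <= H x.
  by move=> Dx; apply: nneseries_ge0 => k _ _; rewrite lee_fin h0.
have iH : mu.-integrable D H.
  apply/integrableP; split => //.
  rewrite (eq_integral H); last by move=> x /set_mem Dx; rewrite gee0_abs// H0.
  rewrite integral_nneseries//; last by move=> k x Dx; rewrite lee_fin h0.
  apply: (@le_lt_trans _ _ 1%:E); last by rewrite ltry.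
  apply: le_trans (epsilon_trick0 xpredT ler01).
  apply: lee_nneseries => [k _ _|k _]; last exact: ltW.
  by apply: integral_ge0 => x Dx; rewrite lee_fin h0.
have iGH : mu.-integrable D (fun x => (G x)%:E + c%:E * H x).
  by apply: integrableD => //; exact: integrableZl.
have hH k x : D x -> (h (J k) x)%:E <= H x.
  move=> Dx; rewrite /H (@nneseriesD1 _ _ k)//; last first.
    by move=> i _; rewrite lee_fin h0.
  by rewrite leeDl// nneseries_ge0// => i _ _; rewrite lee_fin h0.
have lim0 : {ae mu, forall x, D x -> (EFin \o F (J k)) x @[k --> \oo] --> cst 0 x}.
  apply: ae_imply (integrable_ae mD iH) => x Hfin Dx.
  have tail : \sum_(N <= k <oo) (h (J k) x)%:E @[N --> \oo] --> 0.
    apply: nneseries_tail_cvg; last by move=> k _; rewrite lee_fin h0.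
    by have := Hfin Dx; rewrite ge0_fin_numE// H0.
  apply: ge0_cvge0 => [k|e' e'0]; first by rewrite lee_fin F0.
  have [d' d'0 d'P] := ctrl x Dx e' e'0.
  move/fine_cvgP : tail => [fin /cvgr0Pnorm_lt/(_ _ d'0)].
  apply: filterS2 fin => k fk tk /=; rewrite lte_fin; apply: d'P.
  rewrite -lte_fin; apply: le_lt_trans (_ : \sum_(k <= i <oo) (h (J i) x)%:E < _).
    rewrite (@nneseries_split _ _ k 1); last by move=> i _; rewrite lee_fin h0.
    rewrite addn1 big_nat1 leeDl// nneseries_ge0// => i _ _.
    by rewrite lee_fin h0.
  move: tk; rewrite ger0_norm ?fine_ge0//; last first.
    by apply: nneseries_ge0 => i _ _; rewrite lee_fin h0.
  by rewrite -lte_fin fineK.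
have mFJ k : measurable_fun D (EFin \o F (J k)) by exact/measurable_EFinP.
have bound : {ae mu, forall x k, D x ->
    `|(EFin \o F (J k)) x| <= (G x)%:E + c%:E * H x}.
  apply: aeW => x k Dx /=; rewrite ger0_norm ?F0//.
  apply: (@le_trans _ _ (G x + c * h (J k) x)%:E); first by rewrite lee_fin FG.
  by rewrite EFinD EFinM leeD2l// lee_wpmul2l ?lee_fin// hH.
have [_ _] := dominated_convergence mD mFJ (measurable_cst _) lim0 iGH bound.
rewrite integral0 => lim.
have : e%:E <= 0.
  by apply: (cvge_ge _ lim); apply: nearW => k; exact: FJ.
by rewrite lee_fin leNgt e0.
Qed.

End vanishing_integrals.

(** * Convergence of the bulk integrals *)

Section convergence_in_mean.
Local Open Scope ereal_scope.

Lemma cvg_integral_in_mean d (T : measurableType d) (R : realType)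
    (mu : {measure set T -> \bar R}) (D : set T) (f_ : nat -> T -> R)
    (f : T -> R) :
  measurable D -> (forall j, measurable_fun D (f_ j)) ->
  mu.-integrable D (EFin \o f) ->
  \int[mu]_(x in D) (`|f_ j x - f x|)%:E @[j --> \oo] --> 0 ->
  \int[mu]_(x in D) (f_ j x)%:E @[j --> \oo] --> \int[mu]_(x in D) (f x)%:E.
Proof.
move=> mD mf_ intf lim0.
have fin : \int[mu]_(x in D) (f x)%:E \is a fin_num by exact: integrable_fin_num.
have mf : measurable_fun D f by exact/measurable_EFinP/(measurable_int _ intf).
apply/sube_cvg0 => //; apply/cvg_abse0P.
apply: (@squeeze_cvge _ _ _ _ (cst 0) _
  (fun j => \int[mu]_(x in D) (`|f_ j x - f x|)%:E)) => //; last exact: cvg_cst.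
move/fine_cvgP : (lim0) => [finj _]; apply: filterS finj => j finj.
rewrite abse_ge0/=.
have intB : mu.-integrable D (EFin \o (f_ j \- f)%R).
  apply/integrableP; split.
    by apply/measurable_EFinP; exact: measurable_funB.
  by rewrite -ge0_fin_numE// integral_ge0.
have intj : mu.-integrable D (EFin \o f_ j).
  have := integrableD mD intB intf; apply: eq_integrable => // x _ /=.
  by rewrite -EFinD subrK.
rewrite -integralB//; apply: le_trans (le_abse_integral _ _ _) _ => //.
by apply: emeasurable_funB; exact/measurable_EFinP.
Qed.

End convergence_in_mean.

Section bulk_convergence.
Context {R : realType} {n : nat}.
Notation V := 'rV[R]_n.
Notation leb := (lebesgueN R n).
Notation LT := (caratheodory_type (lebesgueO R n)).

Lemma lebesgue_bounded_fin (Om : set V) : bounded_set Om -> (leb Om < +oo)%E.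
Proof.
move=> [M [_ bM]]; have OmM x : Om x -> `|x| <= M + 1.
  by move=> Omx; apply: (bM (M + 1)) => //; rewrite ltrDl.
pose N := `|M + 1|.
apply: (@le_lt_trans _ _ (leb (ebox (const_mx (- N)) (const_mx N)))).
  apply: le_cover_outer => x Omx i; rewrite !mxE -ler_norml.
  by rewrite (le_trans (entry_le_mx_norm _ _ _))// (le_trans (OmM _ Omx))// ler_norm.
apply: le_lt_trans (lebesgue_ebox_le _) _; last by rewrite ltry.
by move=> i; rewrite !mxE (@le_trans _ _ 0)// ?oppr_le0 /N.
Qed.

Lemma powR_add_le (a b p : R) : 0 <= a -> 0 <= b -> 0 <= p ->
  (a + b) `^ p <= 2 `^ p * (a `^ p + b `^ p).
Proof.
move=> a0 b0 p0; wlog ab : a b a0 b0 / a <= b => [H|].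
  have [ab|/ltW ba] := leP a b; first exact: H.
  by rewrite addrC [X in _ * X]addrC; exact: H.
apply: (@le_trans _ _ ((2 * b) `^ p)).
  by apply: ge0_ler_powR; rewrite ?nnegrE//; lra.
by rewrite powRM// ler_wpM2l ?powR_ge0// lerDr powR_ge0.
Qed.

(** The growth bound turns convergence in [L^p] of the [F_ j] into
    convergence in mean of their images under a continuous [Psi]. *)
Lemma cvg_integral_growth (p C : R) (Om : set V) k l
    (F_ : nat -> V -> 'M[R]_(k, l)) (F : V -> 'M[R]_(k, l))
    (Psi : 'M[R]_(k, l) -> R) :
  open Om -> bounded_set Om -> 0 < p -> 0 <= C -> continuous Psi ->
  (forall xi, `|Psi xi| <= C * (enorm xi `^ p + 1)) ->
  memLp p Om F -> cvgLp p Om F_ F ->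
  leb.-integrable Om (fun x => (Psi (F x))%:E) /\
  (\int[leb]_(x in Om) (Psi (F_ j x))%:E @[j --> \oo] -->
   \int[leb]_(x in Om) (Psi (F x))%:E)%E.
Proof.
move=> oOm bOm p0 C0 cPsi PsiC [mF intF] [memF_ lim0].
have mOm : measurable (Om : set LT) by exact: lebesgue_open.
have mF_ j i i' : measurable_fun (Om : set LT) (fun x => F_ j x i i').
  by have [] := memF_ j.
have mPF : measurable_fun (Om : set LT) (fun x => Psi (F x)).
  exact: (measurable_continuous mF cPsi).
have mPF_ j : measurable_fun (Om : set LT) (fun x => Psi (F_ j x)).
  exact: (measurable_continuous (mF_ j) cPsi).
have mpow (G : V -> 'M[R]_(k, l)) :
    (forall i j, measurable_fun (Om : set LT) (fun x => G x i j)) ->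
    measurable_fun (Om : set LT) (fun x => enorm (G x) `^ p).
  move=> mG; apply: (measurableT_comp (@measurable_powR R p)).
  exact: measurable_enorm.
have intcst c : leb.-integrable Om (EFin \o (fun=> c) : V -> \bar R).
  apply: (@measurable_bounded_integrable _ LT R leb (fun=> c) Om) => //.
    exact: lebesgue_bounded_fin.
  by exists `|c|; split; rewrite ?num_real// => x cx y _; exact: ltW.
have intFp : leb.-integrable Om (EFin \o (fun x : LT => enorm (F x) `^ p)).
  apply/integrableP; split; first exact/measurable_EFinP/mpow.
  rewrite (eq_integral (fun x : LT => (enorm (F x) `^ p)%:E))// => x _ /=.
  by rewrite ger0_norm// powR_ge0.
have intlin a b : leb.-integrable Om (EFin \o (fun x : LT => a * enorm (F x) `^ p + b)).
  apply: (@eq_integrable _ LT R leb Om mOm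
    (fun x : LT => a%:E * (enorm (F x) `^ p)%:E + b%:E)%E) => //.
  by apply: integrableD => //; [exact: integrableZl|exact: intcst].
have intPF : leb.-integrable Om (EFin \o (fun x : LT => Psi (F x))).
  apply: (le_integrable mOm _ _ (intlin C C)); first exact/measurable_EFinP.
  move=> x _ /=; rewrite lee_fin; apply: le_trans (PsiC _) _.
  by rewrite mulrDr mulr1 ler_norm.
split=> //; apply: cvg_integral_in_mean => //.
pose P2 := 2 `^ p; have P20 : 0 <= P2 by exact: powR_ge0.
pose Fd j (x : LT) := `|Psi (F_ j x) - Psi (F x)|.
pose h j (x : LT) := enorm (F_ j x - F x) `^ p.
pose G (x : LT) := C * (P2 + 1) * enorm (F x) `^ p + C *+ 2.
have mFd j : measurable_fun (Om : set LT) (Fd j).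
  apply: (measurableT_comp (@normr_measurable _ _)).
  exact: measurable_funB.
have mh j : measurable_fun (Om : set LT) (h j).
  apply: mpow => i i'.
  have -> : (fun x : LT => (F_ j x - F x) i i') =
      (fun x => F_ j x i i' - F x i i').
    by apply/funext => x; rewrite !mxE.
  by apply: measurable_funB; [exact: mF_|exact: mF].
have Fd_le j x : Om x -> Fd j x <= G x + C * P2 * h j x.
  move=> _; apply: le_trans (ler_normB _ _) _.
  apply: le_trans (lerD (PsiC _) (PsiC _)) _.
  have FjF : enorm (F_ j x) `^ p <= P2 * (enorm (F x) `^ p + enorm (F_ j x - F x) `^ p).
    apply: le_trans (powR_add_le (enorm_ge0 _) (enorm_ge0 _) (ltW p0)).
    apply: ge0_ler_powR; rewrite ?nnegrE ?addr_ge0 ?enorm_ge0 ?(ltW p0)//.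
    exact: ler_enormB.
  have := ler_wpM2l C0 FjF; rewrite /G /h mulr2n; lra.
have ctrl x : Om x -> forall e : R, 0 < e -> exists2 d : R, 0 < d &
    forall j, h j x < d -> Fd j x < e.
  move=> _ e e0.
  have /(@cvgrPdist_lt _ _ _ (nbhs (F x)))/(_ e e0)/nbhs_normP[r /= r0 rP] :=
    cPsi (F x).
  exists (r `^ p); first by rewrite powR_gt0.
  move=> j hj; rewrite /Fd distrC; apply: rP => /=.
  rewrite distrC; apply: le_lt_trans (mx_norm_le_enorm _) _.
  rewrite ltNge; apply/negP => rj; move: hj; rewrite ltNge => /negP; apply.
  by apply: ge0_ler_powR; rewrite ?nnegrE ?enorm_ge0// ltW.
apply: (@controlled_integrals_vanish _ LT R leb Om Fd h G (C * P2) mOm mFd mh _ _ _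
  (intlin _ _) Fd_le lim0 ctrl).
- by move=> j x _; exact: normr_ge0.
- by move=> j x _; exact: powR_ge0.
- exact: mulr_ge0.
Qed.

End bulk_convergence.

(** * Convergence of surface densities *)

Section surface_densities.
Context {R : realType} {n m : nat}.
Notation V := 'rV[R]_n.
Notation M := 'rV[R]_m.
Variables (g0 : R -> R) (g : M -> V -> R) (C : R).
Hypotheses (g0_ge0 : forall t, 0 <= t -> 0 <= g0 t)
  (g0_nd : forall t t', 0 <= t -> t <= t' -> g0 t <= g0 t')
  (g0_eq0 : forall t, 0 <= t -> (g0 t = 0 <-> t = 0)).
Hypotheses (C0 : 0 < C)
  (cg : {within [set z : M * V | enorm z.2 = 1], continuous (fun z => g z.1 z.2)})
  (g_ge0 : forall t v, enorm v = 1 -> 0 <= g t v)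
  (g_sub : forall t t' v, enorm v = 1 -> g (t + t') v <= g t v + C * g0 (enorm t'))
  (g_0 : forall v, enorm v = 1 -> g 0 v = 0).

(** The surface density extended by [0] to vectors that are not unit vectors,
    so that integrals over jump sets become integrals over the whole space. *)
Definition gext (t : M) (v : V) : R := if enorm v == 1 then g t v else 0.

Lemma gext_ge0 t v : 0 <= gext t v.
Proof. by rewrite /gext; case: eqP => // v1; exact: g_ge0. Qed.

Lemma g_le t v : enorm v = 1 -> g t v <= C * g0 (enorm t).
Proof. by move=> v1; rewrite -[t]add0r (le_trans (g_sub _ _ v1))// g_0// !add0r. Qed.

Lemma g_dist t t' v : enorm v = 1 ->
  `|g t v - g t' v| <= C * g0 (enorm (t - t')).
Proof.
move=> v1; have := g_sub t' (t - t') v1; have := g_sub t (t' - t) v1.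
rewrite ![_ + (_ - _)]addrC !subrK [enorm (t' - t)]enormB => A B.
by rewrite ler_norml; apply/andP; split; lra.
Qed.

Lemma g_continuous_normal t v e : enorm v = 1 -> 0 < e -> exists2 r, 0 < r &
  forall v', enorm v' = 1 -> enorm (v' - v) < r -> `|g t v' - g t v| < e.
Proof.
move=> v1 e0; move/subspace_continuousP : cg => /(_ (t, v) v1) cgv.
have /nbhs_ballP[r /= r0 rP] : nbhs (t, v) (fun z : M * V =>
    enorm z.2 = 1 -> `|g t v - g z.1 z.2| < e).
  by move/cvgrPdist_lt : cgv => /(_ _ e0).
exists r => // v' v'1 v'r; rewrite distrC; apply: (rP (t, v')) => //.
split => /=; first exact: ballxx.
rewrite mx_norm_ball /ball_/=; apply: le_lt_trans (mx_norm_le_enorm _) _.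
by rewrite enormB.
Qed.

Lemma measurable_g0_enorm d (T : measurableType d) (D : set T) (t : T -> R) :
  measurable_fun D t -> (forall x, 0 <= t x) ->
  measurable_fun D (fun x => g0 (t x)).
Proof.
move=> mt t0.
have -> : (fun x => g0 (t x)) = (fun r => g0 (Num.max 0 r)) \o t.
  by apply/funext => x /=; rewrite (max_idPr (t0 x)).
apply: measurableT_comp => //; apply: nondecreasing_measurable => // a b ab.
apply: g0_nd; first by rewrite le_max lexx.
by rewrite ge_max !le_max lexx ab orbT.
Qed.

Lemma measurable_gext d (T : measurableType d) (s : T -> M) (nu : T -> V) :
  (forall i j, measurable_fun setT (fun x => s x i j)) ->
  (forall i j, measurable_fun setT (fun x => nu x i j)) ->
  measurable_fun setT (fun x => gext (s x) (nu x)).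
Proof.
move=> ms mnu; pose D := [set x | enorm (nu x) = 1].
have mD : measurable D.
  by have := measurable_enorm mnu measurableT (measurable_set1 1); rewrite setTI.
pose S : set 'M[R]_(1, m + n) := [set w | enorm (rsubmx w) = 1].
have cw : {within S, continuous (fun w => g (lsubmx w) (rsubmx w))}.
  apply/subspace_continuousP => w Sw.
  move/subspace_continuousP : cg => /(_ (lsubmx w, rsubmx w) Sw) cgw.
  apply: (@cvg_comp _ _ _ (fun w' : 'M[R]_(1, m + n) => (lsubmx w', rsubmx w'))
    (fun z : M * V => g z.1 z.2) _ _ _ _ cgw) => A.
  move=> /nbhs_ballP[r /= r0 rA]; apply/nbhs_ballP.
  exists r => // w' [_ ww'] Sw'; apply: (rA (lsubmx w', rsubmx w')) => //.
  by split; split => // i j; rewrite !mxE; exact: ww'.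
have mrow i j : measurable_fun D (fun x => row_mx (s x) (nu x) i j).
  apply: (measurable_funS measurableT) => //.
  case: (splitP j) => j' jj'.
    rewrite (_ : (fun x => _) = (fun x => s x i j')); first exact: ms.
    by apply/funext => x; rewrite (_ : j = lshift n j') ?row_mxEl//; exact: val_inj.
  rewrite (_ : (fun x => _) = (fun x => nu x i j')); first exact: mnu.
  by apply/funext => x; rewrite (_ : j = rshift m j') ?row_mxEr//; exact: val_inj.
have mg : measurable_fun D (fun x => g (s x) (nu x)).
  have := measurable_within_continuous mrow cw.
  rewrite (_ : _ \o _ = (fun x => g (s x) (nu x))).
    by apply => x Dx; rewrite /S/= row_mxKr.
  by apply/funext => x /=; rewrite row_mxKl row_mxKr.
have /measurable_restrictT := mg; move/(_ mD).
rewrite (_ : _ \_ D = (fun x => gext (s x) (nu x)))//.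
apply/funext => x; rewrite /patch /gext; case: eqP => nux.
  by rewrite mem_set.
by rewrite memNset.
Qed.

End surface_densities.

Section surface_convergence.
Context {R : realType} {n m k : nat}.
Notation V := 'rV[R]_n.
Notation M := 'rV[R]_m.
Notation surf := (hausdorff R n k).
Notation HT := (caratheodory_type (hausdorffO R n k)).

(** What a pair of jump and normal satisfies when both are extended by [0]. *)
Definition jump_like (s : V -> M) (nu : V -> V) :=
  forall x, (enorm (nu x) = 1 /\ s x != 0) \/ (nu x = 0 /\ s x = 0).

(** The difference of the two densities is controlled by the two integrands
    whose integrals vanish, except for the variation of [g] in the normal at a
    fixed jump. There, as [g0 |s| > 0], the second integrand controls the
    difference of the normals pointwise, while [2 C g0 |s|] is an integrable
    bound. *)
Lemma surface_density_cvg (g0 : R -> R) (g : M -> V -> R) (C : R)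
    (s : V -> M) (nu : V -> V) (t_ : nat -> V -> M) (tau_ : nat -> V -> V) :
  (forall t, 0 <= t -> 0 <= g0 t) ->
  (forall t t', 0 <= t -> t <= t' -> g0 t <= g0 t') ->
  (forall t, 0 <= t -> (g0 t = 0 <-> t = 0)) ->
  0 < C ->
  {within [set z : M * V | enorm z.2 = 1], continuous (fun z => g z.1 z.2)} ->
  (forall t v, enorm v = 1 -> 0 <= g t v) ->
  (forall t t' v, enorm v = 1 -> g (t + t') v <= g t v + C * g0 (enorm t')) ->
  (forall v, enorm v = 1 -> g 0 v = 0) ->
  jump_like s nu -> (forall j, jump_like (t_ j) (tau_ j)) ->
  (forall i j, measurable_fun setT (fun x : HT => s x i j)) ->
  (forall i j, measurable_fun setT (fun x : HT => nu x i j)) ->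
  (forall l i j, measurable_fun setT (fun x : HT => t_ l x i j)) ->
  (forall l i j, measurable_fun setT (fun x : HT => tau_ l x i j)) ->
  surf.-integrable setT (fun x => (g0 (enorm (s x)))%:E) ->
  (\int[surf]_x (g0 (enorm (s x - t_ j x)))%:E)%E @[j --> \oo] --> 0%E ->
  (\int[surf]_x (g0 (enorm (s x) + enorm (t_ j x)) *
      enorm (nu x - tau_ j x))%R%:E)%E @[j --> \oo] --> 0%E ->
  surf.-integrable setT (fun x => (gext g (s x) (nu x))%:E) /\
  (\int[surf]_x (gext g (t_ j x) (tau_ j x))%:E)%E @[j --> \oo] -->
  (\int[surf]_x (gext g (s x) (nu x))%:E)%E.
Proof.
move=> g0_ge0 g0_nd g0_eq0 C0 cg g_ge0 g_sub g_0 Jnu Jtau ms mnu mt mtau intg0 lim1 lim2.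
have g00 : g0 0 = 0 by apply/g0_eq0.
have C0' := ltW C0.
have gle := g_le g_sub g_0; have gdist := g_dist g_sub.
have mf : measurable_fun setT (fun x : HT => gext g (s x) (nu x)).
  exact: measurable_gext.
have mf_ j : measurable_fun setT (fun x : HT => gext g (t_ j x) (tau_ j x)).
  by apply: measurable_gext.
have unit1 (v : V) : enorm v = 1 -> (enorm v == 1) = true by move=> ->; rewrite eqxx.
have zero1 : (enorm (0 : V) == 1) = false by rewrite enorm0 eq_sym oner_eq0.
have gext_le (t : M) (v : V) : gext g t v <= C * g0 (enorm t).
  rewrite /gext; case: eqP => [v1|_]; first exact: gle.
  by rewrite mulr_ge0// g0_ge0// enorm_ge0.
have intC c : surf.-integrable setT (EFin \o (fun x : HT => c * g0 (enorm (s x)))).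
  apply: (@eq_integrable _ HT R surf setT measurableT
    (fun x : HT => c%:E * (g0 (enorm (s x)))%:E)%E) => //.
  exact: integrableZl.
have intf : surf.-integrable setT (EFin \o (fun x : HT => gext g (s x) (nu x))).
  apply: (le_integrable measurableT _ _ (intC C)); first exact/measurable_EFinP.
  move=> x _ /=; rewrite lee_fin ger0_norm; last exact: gext_ge0.
  by apply: le_trans (gext_le _ _) _; exact: ler_norm.
split=> //; apply: cvg_integral_in_mean => //.
pose F j (x : HT) := `|gext g (t_ j x) (tau_ j x) - gext g (s x) (nu x)|.
pose h1 j (x : HT) := g0 (enorm (s x - t_ j x)).
pose h2 j (x : HT) := g0 (enorm (s x) + enorm (t_ j x)) * enorm (nu x - tau_ j x).
pose G (x : HT) := (2 * C) * g0 (enorm (s x)).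
have mF j : measurable_fun setT (F j).
  apply: (measurableT_comp (@normr_measurable _ _)).
  exact: measurable_funB.
have mB k' l (a b : HT -> 'M[R]_(k', l)) :
    (forall i j, measurable_fun setT (fun x : HT => a x i j)) ->
    (forall i j, measurable_fun setT (fun x : HT => b x i j)) ->
    measurable_fun setT (fun x : HT => enorm (a x - b x)).
  move=> ma mb; apply: measurable_enorm => i j.
  rewrite (_ : (fun x => _) = (fun x => a x i j - b x i j)); last first.
    by apply/funext => x; rewrite !mxE.
  by apply: measurable_funB; [exact: ma|exact: mb].
have mh1 j : measurable_fun setT (h1 j).
  exact: (measurable_g0_enorm g0_nd (mB _ _ _ _ ms (mt j)) (fun x => enorm_ge0 _)).
have mh2 j : measurable_fun setT (h2 j).
  apply: measurable_funM; last exact: (mB _ _ _ _ mnu (mtau j)).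
  apply: (measurable_g0_enorm g0_nd).
    by apply: measurable_funD; apply: measurable_enorm; [exact: ms|exact: mt].
  by move=> x; rewrite addr_ge0 ?enorm_ge0.
have h10 j x : 0 <= h1 j x by rewrite g0_ge0// enorm_ge0.
have h20 j x : 0 <= h2 j x.
  by rewrite mulr_ge0 ?enorm_ge0// g0_ge0// addr_ge0 ?enorm_ge0.
pose h j x := h1 j x + h2 j x.
have mh j : measurable_fun setT (h j) by exact: measurable_funD.
have limh : (\int[surf]_x (h j x)%:E)%E @[j --> \oo] --> 0%E.
  have -> : (fun j => \int[surf]_x (h j x)%:E)%E =
      (fun j => \int[surf]_x (h1 j x)%:E + \int[surf]_x (h2 j x)%:E)%E.
    apply/funext => j.
    have p1 (x : HT) : [set: HT] x -> (0 <= (h1 j x)%:E)%E.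
      by move=> _; rewrite lee_fin; exact: h10.
    have p2 (x : HT) : [set: HT] x -> (0 <= (h2 j x)%:E)%E.
      by move=> _; rewrite lee_fin; exact: h20.
    have m1 : measurable_fun setT (fun x : HT => (h1 j x)%:E).
      exact/measurable_EFinP/mh1.
    have m2 : measurable_fun setT (fun x : HT => (h2 j x)%:E).
      exact/measurable_EFinP/mh2.
    exact: (ge0_integralD surf measurableT p1 m1 p2 m2).
  rewrite -[X in _ --> X]adde0; apply: cvgeD; [by []|exact: lim1|exact: lim2].
have F_le j (x : HT) : [set: HT] x -> F j x <= G x + C * h j x.
  move=> _; have s0 : 0 <= C * g0 (enorm (s x)).
    by rewrite mulr_ge0// g0_ge0// enorm_ge0.
  have ch1 : 0 <= C * h1 j x by rewrite mulr_ge0.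
  have ch2 : 0 <= C * h2 j x by rewrite mulr_ge0.
  apply: (@le_trans _ _ (G x + C * h1 j x)); last first.
    by rewrite lerD2l /h mulrDr lerDl.
  rewrite /F /gext; have := Jtau j x; have := Jnu x.
  case=> [[nu1 _]|[nu0 sx0]] [[tau1 _]|[tau0 tx0]].
  - rewrite (unit1 _ nu1) (unit1 _ tau1); have := gdist (t_ j x) (s x) _ tau1.
    rewrite enormB -/(h1 j x) => A; have B1 := gle (s x) _ tau1.
    have B2 := gle (s x) _ nu1; have P1 := g_ge0 (s x) _ tau1.
    have P2 := g_ge0 (s x) _ nu1; move: A; rewrite /G !ler_norml.
    move=> /andP[A1 A2]; apply/andP; split; lra.
  - rewrite (unit1 _ nu1) tau0 zero1 sub0r normrN ger0_norm ?g_ge0//.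
    by have := gle (s x) _ nu1; rewrite /G; lra.
  - rewrite (unit1 _ tau1) nu0 zero1 subr0 ger0_norm ?g_ge0//.
    have := gle (t_ j x) _ tau1.
    by rewrite /G /h1 sx0 sub0r enormN enorm0 g00; lra.
  - by rewrite tau0 nu0 zero1 subrr normr0 /G; lra.
have ctrl (x : HT) : [set: HT] x -> forall e : R, 0 < e -> exists2 d : R, 0 < d &
    forall j, h j x < d -> F j x < e.
  move=> _ e e0; have [[nu1 sx]|[nu0 sx0]] := Jnu x; last first.
    exists (e / C); first by rewrite divr_gt0.
    move=> j hj; apply: (@le_lt_trans _ _ (C * h j x)); last first.
      by rewrite mulrC -ltr_pdivlMr.
    apply: (@le_trans _ _ (C * h1 j x)); last by rewrite ler_wpM2l// lerDl.
    rewrite /F {2}/gext nu0 zero1 subr0 ger0_norm; last exact: gext_ge0.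
    by apply: le_trans (gext_le _ _) _; rewrite /h1 sx0 sub0r enormN.
  have gs0 : 0 < g0 (enorm (s x)).
    rewrite lt0r g0_ge0 ?enorm_ge0// andbT; apply/eqP => /g0_eq0.
    by move=> /(_ (enorm_ge0 _)) /enorm_eq0/eqP; apply/negP.
  have e2 : 0 < e / 2 by rewrite divr_gt0.
  have [r r0 rP] := g_continuous_normal cg (s x) nu1 e2.
  (* The three bounds make the variation in the jump and in the normal small,
     and exclude [tau_ j x = 0], where the normals are at distance [1]. *)
  pose d := Num.min (Num.min (e / 2 / C) (g0 (enorm (s x)) * r)) (g0 (enorm (s x))).
  exists d; first by rewrite /d !lt_min gs0 (mulr_gt0 gs0 r0) (divr_gt0 e2 C0).
  move=> j; rewrite /d !lt_min => /andP[/andP[d1 d2] d3].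
  have h1h : h1 j x <= h j x by rewrite lerDl.
  have h2h : h2 j x <= h j x by rewrite lerDr.
  have gh2 : g0 (enorm (s x)) * enorm (nu x - tau_ j x) <= h2 j x.
    by rewrite ler_wpM2r ?enorm_ge0// g0_nd ?enorm_ge0// lerDl enorm_ge0.
  rewrite /F /gext; have [[tau1 _]|[tau0 tx0]] := Jtau j x; last first.
    exfalso; move: gh2; rewrite tau0 subr0 nu1 mulr1 leNgt => /negP; apply.
    exact: le_lt_trans h2h d3.
  rewrite (unit1 _ nu1) (unit1 _ tau1); have A := gdist (t_ j x) (s x) _ tau1.
  have B : `|g (s x) (tau_ j x) - g (s x) (nu x)| < e / 2.
    apply: rP => //; rewrite enormB -(ltr_pM2l gs0).
    exact: le_lt_trans gh2 (le_lt_trans h2h d2).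
  have Ch : C * h1 j x < e / 2.
    by rewrite mulrC -ltr_pdivlMr//; exact: le_lt_trans h1h d1.
  move: A; rewrite enormB -/(h1 j x) => A.
  have := ler_normD (g (t_ j x) (tau_ j x) - g (s x) (tau_ j x))
    (g (s x) (tau_ j x) - g (s x) (nu x)).
  by rewrite addrA subrK; lra.
apply: (@controlled_integrals_vanish _ HT R surf setT F h G C measurableT mF mh _ _ C0'
  (intC _) F_le limh ctrl).
- by move=> j x _; exact: normr_ge0.
- by move=> j x _; rewrite addr_ge0.
Qed.

End surface_convergence.

(** * Jump pairs and change of variables *)

Section jump_pairs.
Context {R : realType} {n m : nat}.
Notation V := 'rV[R]_n.
Notation M := 'rV[R]_m.

Lemma integral_support d (T : measurableType d)
    (mu : {measure set T -> \bar R})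
    (D : set T) (f : T -> \bar R) : (forall x, ~ D x -> f x = 0%E) ->
  (\int[mu]_(x in D) f x = \int[mu]_x f x)%E.
Proof.
move=> f0; rewrite integral_mkcond; congr integral; apply/funext => x.
by rewrite /patch; case: ifPn => // /negP; rewrite inE => /f0.
Qed.

Lemma jump_pair_like (Om : set V) (u s : V -> M) (nu : V -> V) :
  jump_pair Om u s nu -> jump_like s nu.
Proof.
move=> [jin jout _ _] x; have [Jx|Jx] := pselect (jump_set Om u x).
  left; have [a [b [[ab nu1 _ _] ->]]] := jin x Jx.
  by rewrite subr_eq0.
by right; have [-> ->] := jout x Jx.
Qed.

Lemma jump_pair_unit (Om : set V) (u s : V -> M) (nu : V -> V) x :
  jump_pair Om u s nu -> jump_set Om u x -> enorm (nu x) = 1.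
Proof. by move=> [jin _ _ _] /jin[a [b [[]]]]. Qed.

Lemma integral_jump_set k (g : M -> V -> R) (Om : set V) (u s : V -> M)
    (nu : V -> V) : jump_pair Om u s nu ->
  (\int[hausdorff R n k]_(x in jump_set Om u) (g (s x) (nu x))%:E =
   \int[hausdorff R n k]_x (gext g (s x) (nu x))%:E)%E.
Proof.
move=> jp; rewrite -(@integral_support _ _ (hausdorff R n k) (jump_set Om u)); last first.
  move=> x Jx; have [_ /(_ x Jx)[_ nu0] _ _] := jp.
  by rewrite /gext nu0 enorm0 eq_sym oner_eq0.
apply: eq_integral => x /set_mem Jx.
by rewrite /gext (jump_pair_unit jp Jx) eqxx.
Qed.

(** The two orientations of a jump set differ by a sign, which an even density
    does not see. *)
Lemma gext_orientation (g : M -> V -> R) (Om : set V) (u s s' : V -> M)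
    (nu nu' : V -> V) :
  open Om ->
  (forall i j, measurable_fun (Om : set (caratheodory_type (lebesgueO R n)))
     (fun y => u y i j)) ->
  (forall t v, enorm v = 1 -> g (- t) (- v) = g t v) ->
  jump_pair Om u s nu -> jump_pair Om u s' nu' ->
  forall x, gext g (s x) (nu x) = gext g (s' x) (nu' x).
Proof.
move=> oOm mu gN [jin jout _ _] [jin' jout' _ _] x.
have [Jx|Jx] := pselect (jump_set Om u x); last first.
  by have [-> ->] := jout x Jx; have [-> ->] := jout' x Jx.
have [a [b [ju ->]]] := jin x Jx; have [a' [b' [ju' ->]]] := jin' x Jx.
have [Omx _] := Jx; have [_ nu'1 _ _] := ju'.
have [[-> ->]//|[-> ->]] := approx_jump_unique oOm Omx mu ju ju'.
by rewrite /gext enormN nu'1 eqxx gN.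
Qed.

End jump_pairs.

Section change_of_variables.
Context {R : realType} {n : nat}.
Notation V := 'rV[R]_n.
Notation leb := (lebesgueN R n).

Lemma ess_sup_bound (f : V -> R) (c : R) :
  ess_sup leb (fun x => (f x)%:E) \is a fin_num ->
  c = `|fine (ess_sup leb (fun x => (f x)%:E))| ->
  {ae leb, forall x, f x <= c}.
Proof.
move=> fin ->.
have := @ess_sup_ge _ _ _ leb (fun x => (f x)%:E).
apply: ae_imply => x fx; rewrite -lee_fin; apply: le_trans fx _.
by rewrite -[leLHS]fineK// lee_fin ler_norm.
Qed.

Lemma ge0_integral_lipschitz_leT k L (f : V -> V) (G : V -> \bar R) :
  0 < L -> elipschitz L f -> (forall y, exists x, f x = y) ->
  measurable_fun setT (G : borelN R n -> \bar R) -> (forall x, 0 <= G x)%E ->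
  (\int[hausdorff R n k]_y G y <=
   (L ^+ k)%:E * \int[hausdorff R n k]_x G (f x))%E.
Proof.
move=> L0 fL fsurj mG G0.
have := ge0_integral_lipschitz_le k L0 fL fsurj
  (@measurableT _ (borelN R n)) mG G0.
by rewrite preimage_setT.
Qed.

(** The Jacobian bound makes [Phi_ j] a perturbation of the identity by a map
    with small Lipschitz constant, so that the change of variables costs
    factors that tend to [1]. *)
Lemma cvg_integral_near_identity k (Phi_ : nat -> V -> V)
    (G_ : nat -> V -> R) (l : R) :
  (forall j, lipschitz (Phi_ j)) ->
  (forall j, {ae leb, forall x, differentiable (Phi_ j) (x : V)}) ->
  ess_sup leb (fun x => (enorm ('J (Phi_ j) (x : V) - 1%:M))%:E)
    @[j --> \oo] --> 0%E ->
  (forall j, measurable_fun setT (G_ j : borelN R n -> R)) ->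
  (forall j x, 0 <= G_ j x) ->
  (\int[hausdorff R n k]_x (G_ j (Phi_ j x))%:E)%E @[j --> \oo] --> l%:E ->
  (\int[hausdorff R n k]_x (G_ j x)%:E)%E @[j --> \oo] --> l%:E.
Proof.
move=> PhiL Phid; set E := (fun j => ess_sup _ _) => Elim mG G0 alim.
pose c j := `|fine (E j)|.
have [Efin Elim'] := (fine_cvgP _ _).1 Elim.
have clim : c @ \oo --> 0 by rewrite -[X in _ --> X](normr0 R); exact: cvg_norm.
have c1 : \forall j \near \oo, c j < 1.
  move/cvgr0Pnorm_lt : clim => /(_ _ ltr01); apply: filterS => j.
  by rewrite ger0_norm// normr_ge0.
pose a j := (\int[hausdorff R n k]_x (G_ j (Phi_ j x))%:E)%E.
pose b j := (\int[hausdorff R n k]_x (G_ j x)%:E)%E.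
have bounds : \forall j \near \oo,
    ((((1 - c j) ^+ k)%:E * a j <= b j) && (b j <= ((1 + c j) ^+ k)%:E * a j))%E.
  apply: filterS2 Efin c1 => j fj cj1.
  have cj0 : 0 <= c j by exact: normr_ge0.
  have near_id := near_identity_lipschitz cj0 (PhiL j) (Phid j)
    (ess_sup_bound fj erefl).
  have c10 : 0 < 1 - c j by rewrite subr_gt0.
  have mGE : measurable_fun setT ((fun x => (G_ j x)%:E) : borelN R n -> \bar R).
    exact/measurable_EFinP.
  have GE0 x : (0 <= (G_ j x)%:E)%E by rewrite lee_fin.
  apply/andP; split; last first.
    have L1 : 0 < 1 + c j by exact: ltr_wpDr.
    exact: (ge0_integral_lipschitz_leT k L1 (near_identity_upper near_id)
      (near_identity_surjective cj1 near_id) mGE GE0).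
  have [f [fK Kf] fL] := near_identity_inverse cj1 near_id.
  have mPhi : measurable_fun setT (Phi_ j : borelN R n -> borelN R n).
    exact: elipschitz_measurable (near_identity_upper near_id).
  have mGPhi : measurable_fun setT
      ((fun x => (G_ j (Phi_ j x))%:E) : borelN R n -> \bar R).
    exact: (measurableT_comp mGE mPhi).
  have ic0 : 0 < (1 - c j)^-1 by rewrite invr_gt0.
  have bE : (\int[hausdorff R n k]_x (G_ j (Phi_ j (f x)))%:E = b j)%E.
    by apply: eq_integral => x _; rewrite Kf.
  have := ge0_integral_lipschitz_leT k ic0 fL
    (fun y => ex_intro _ (Phi_ j y) (fK y)) mGPhi (fun x => GE0 _).
  rewrite bE -/(a j) exprVn.
  by rewrite -lee_pdivrMl ?invr_gt0 ?exprn_gt0// invrK.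
have pw (e : nat -> R) : e @ \oo --> (1 : R) ->
    ((e j ^+ k)%:E * a j)%E @[j --> \oo] --> l%:E.
  move=> e1; rewrite -[X in _ --> X]mul1e; apply: cvgeM => //.
    apply: cvg_EFin; first exact: nearW.
    rewrite -[X in _ --> X](expr1n _ k).
    by apply: (@cvg_comp _ _ _ e (fun x => x ^+ k)) e1 _; exact: exprn_continuous.
apply: (squeeze_cvge bounds); apply: pw.
  by rewrite -[X in _ --> X]subr0; apply: cvgB => //; exact: cvg_cst.
by rewrite -[X in _ --> X]addr0; apply: cvgD => //; exact: cvg_cst.
Qed.

End change_of_variables.

(** * Convergence of the energies *)

Theorem corollary2p1 (R : realType) (n m : nat) (Om : set 'rV[R]_n.+1)
    (p : R) (g0 : R -> R)
    (u s : 'rV[R]_n.+1 -> 'rV[R]_m) (nu : 'rV[R]_n.+1 -> 'rV[R]_n.+1)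
    (u_ : nat -> 'rV[R]_n.+1 -> 'rV[R]_m)
    (Phi_ : nat -> 'rV[R]_n.+1 -> 'rV[R]_n.+1) :
  open Om -> bounded_set Om -> lipschitz_set Om ->
  1 <= p ->
  (forall t, 0 <= t -> 0 <= g0 t) ->
  {within `[0, +oo[, continuous g0} ->
  (forall t t', 0 <= t -> t <= t' -> g0 t <= g0 t') ->
  (forall t t', 0 <= t -> 0 <= t' -> g0 (t + t') <= g0 t + g0 t') ->
  (forall t, 0 <= t -> (g0 t = 0 <-> t = 0)) ->
  SBV Om u ->
  jump_pair Om u s nu ->
  memLp p Om (approx_grad u) ->
  (hausdorff R n.+1 n).-integrable (jump_set Om u)
    (fun x => (g0 (enorm (s x)))%:E) ->
  approximating_sequence p g0 Om u s nu u_ Phi_ ->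
  forall (s_ : nat -> 'rV[R]_n.+1 -> 'rV[R]_m)
         (nu_ : nat -> 'rV[R]_n.+1 -> 'rV[R]_n.+1),
  (forall j, jump_pair Om (u_ j) (s_ j) (nu_ j)) ->
  forall (Psi : 'M[R]_(m, n.+1) -> R) (g : 'rV[R]_m -> 'rV[R]_n.+1 -> R),
  continuous Psi ->
  (exists2 C : R, 0 < C & forall xi, `|Psi xi| <= C * (enorm xi `^ p + 1)) ->
  {within [set z : 'rV[R]_m * 'rV[R]_n.+1 | enorm z.2 = 1],
    continuous (fun z => g z.1 z.2)} ->
  (forall t v, enorm v = 1 -> 0 <= g t v) ->
  (forall t v, enorm v = 1 -> g (- t) (- v) = g t v) ->
  (exists2 C : R, 0 < C & forall t t' v, enorm v = 1 ->
    g (t + t') v <= g t v + C * g0 (enorm t')) ->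
  (forall v, enorm v = 1 -> g 0 v = 0) ->
  [/\ (\int[lebesgueN R n.+1]_(x in Om) (Psi (approx_grad (u_ j) x))%:E)%E
        @[j --> \oo] -->
      (\int[lebesgueN R n.+1]_(x in Om) (Psi (approx_grad u x))%:E)%E,
      (\int[hausdorff R n.+1 n]_(x in jump_set Om (u_ j))
         (g (s_ j x) (nu_ j x))%:E)%E @[j --> \oo] -->
      (\int[hausdorff R n.+1 n]_(x in jump_set Om u) (g (s x) (nu x))%:E)%E
    & energy Psi g Om (u_ j) (s_ j) (nu_ j) Om @[j --> \oo] -->
      energy Psi g Om u s nu Om].
Proof.
move=> oOm bOm _ p1 g0_ge0 _ g0_nd _ g0_eq0 sbv jp memG intg0 appr.
move=> s_ nu_ jp_ Psi g cPsi [CPsi CPsi0 PsiC] cg g_ge0 gN [Cg Cg0 g_sub] g_0.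
have [sbv_ [PhiL [_ [_ [LpG [[_ _ Phid PhiJ _] [exJ _]]]]]]] := appr.
have [s' [nu' [jp' lim1 lim2]]] := exJ.
have p0 : 0 < p by exact: lt_le_trans p1.
have [intPsi limPsi] := cvg_integral_growth oOm bOm p0 (ltW CPsi0) cPsi PsiC memG LpG.
have g00 : g0 0 = 0 by apply/g0_eq0.
have mHB := @hausdorff_borel R n.+1 n.
have mcoord l (f : 'rV[R]_n.+1 -> 'rV[R]_l) :
    measurable_fun setT (f : borelN R n.+1 -> borelN R l) ->
    forall i j, measurable_fun setT
      (fun x : caratheodory_type (hausdorffO R n.+1 n) => f x i j).
  by move=> mf; apply/measurable_borelP; exact: (measurableT_comp mf mHB).
have mPhi j : measurable_fun setT (Phi_ j : borelN R n.+1 -> borelN R n.+1).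
  have [L _ PhiLL] := lipschitz_elipschitz (PhiL j).
  exact: elipschitz_measurable PhiLL.
pose t_ j x := s' j (Phi_ j x); pose tau_ j x := nu' j (Phi_ j x).
have Jnu := jump_pair_like jp.
have Jtau j : jump_like (t_ j) (tau_ j) by move=> x; exact: (jump_pair_like (jp' j)).
have [_ _ ms mnu] := jp.
have mt j : measurable_fun setT (t_ j : borelN R n.+1 -> borelN R m).
  by have [_ _ ms' _] := jp' j; exact: (measurableT_comp ms' (mPhi j)).
have mtau j : measurable_fun setT (tau_ j : borelN R n.+1 -> borelN R n.+1).
  by have [_ _ _ mnu'] := jp' j; exact: (measurableT_comp mnu' (mPhi j)).
have out j x : ~ (jump_set Om u `|` Phi_ j @^-1` jump_set Om (u_ j)) x ->
    [/\ s x = 0, nu x = 0, t_ j x = 0 & tau_ j x = 0].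
  move=> /not_orP[nJ nK]; have [_ /(_ x nJ)[-> ->] _ _] := jp.
  by have [_ /(_ _ nK)[tx taux] _ _] := jp' j; split.
have lim1' : (\int[hausdorff R n.+1 n]_x
    (g0 (enorm (s x - t_ j x)))%:E)%E @[j --> \oo] --> 0%E.
  rewrite (_ : (fun j => _) = (fun j => \int[hausdorff R n.+1 n]_(x in
      jump_set Om u `|` Phi_ j @^-1` jump_set Om (u_ j))
      (g0 (enorm (s x - s' j (Phi_ j x))))%:E)%E)//.
  apply/funext => j; rewrite -(@integral_support _ _ _ (hausdorff R n.+1 n)
    (jump_set Om u `|` Phi_ j @^-1` jump_set Om (u_ j)))// => x /out[-> _ -> _].
  by rewrite subrr enorm0 g00.
have lim2' : (\int[hausdorff R n.+1 n]_x
    (g0 (enorm (s x) + enorm (t_ j x)) * enorm (nu x - tau_ j x))%R%:E)%E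
    @[j --> \oo] --> 0%E.
  rewrite (_ : (fun j => _) = (fun j => \int[hausdorff R n.+1 n]_(x in
      jump_set Om u `|` Phi_ j @^-1` jump_set Om (u_ j))
      (g0 (enorm (s x) + enorm (s' j (Phi_ j x)))
        * enorm (nu x - nu' j (Phi_ j x)))%R%:E)%E)//.
  apply/funext => j; rewrite -(@integral_support _ _ _ (hausdorff R n.+1 n)
    (jump_set Om u `|` Phi_ j @^-1` jump_set Om (u_ j)))// => x /out[_ -> _ ->].
  by rewrite subrr enorm0 mulr0.
have mJ : measurable (jump_set Om u : set (caratheodory_type (hausdorffO R n.+1 n))).
  have -> : jump_set Om u = [set x | enorm (nu x) = 1].
    apply/seteqP; split => x; first by move=> Jx; exact: (jump_pair_unit jp Jx).
    move=> /= nu1; apply: contrapT => nJ; have [_ /(_ x nJ)[_ nu0] _ _] := jp.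
    by move: nu1; rewrite nu0 enorm0 => /eqP; rewrite eq_sym oner_eq0.
  have := measurable_enorm (mcoord _ _ mnu) measurableT (measurable_set1 1).
  by rewrite setTI.
have intg0T : (hausdorff R n.+1 n).-integrable setT
    (fun x => (g0 (enorm (s x)))%:E).
  move/(integrable_mkcond _ mJ) : intg0.
  rewrite (_ : _ \_ _ = (fun x => (g0 (enorm (s x)))%:E))//.
  apply/funext => x; rewrite /patch; case: ifPn => // /negP; rewrite inE => nJ.
  by have [_ /(_ x nJ)[-> _] _ _] := jp; rewrite enorm0 g00.
have [intg limg] := surface_density_cvg g0_ge0 g0_nd g0_eq0 Cg0 cg g_ge0 g_sub g_0
  Jnu Jtau (mcoord _ _ ms) (mcoord _ _ mnu) (fun j => mcoord _ _ (mt j))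
  (fun j => mcoord _ _ (mtau j)) intg0T lim1' lim2'.
pose I := (\int[hausdorff R n.+1 n]_x (gext g (s x) (nu x))%:E)%E.
have Ifin : I \is a fin_num by exact: (integrable_fin_num measurableT intg).
have limb : (\int[hausdorff R n.+1 n]_x (gext g (s' j x) (nu' j x))%:E)%E
    @[j --> \oo] --> I.
  rewrite -(fineK Ifin).
  apply: (@cvg_integral_near_identity _ _ _ Phi_
    (fun j x => gext g (s' j x) (nu' j x)) _ PhiL Phid PhiJ).
  - move=> j; have [_ _ ms' mnu'] := jp' j.
    exact: (measurable_gext cg ((measurable_borelP _ _).1 ms')
      ((measurable_borelP _ _).1 mnu')).
  - by move=> j x; exact: gext_ge0.
  - by rewrite fineK.
have surfE j : (\int[hausdorff R n.+1 n]_(x in jump_set Om (u_ j))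
    (g (s_ j x) (nu_ j x))%:E =
    \int[hausdorff R n.+1 n]_x (gext g (s' j x) (nu' j x))%:E)%E.
  rewrite (integral_jump_set _ _ (jp_ j)); apply: eq_integral => x _.
  have [[[[mu _] _] _] _] := sbv_ j.
  by rewrite (gext_orientation oOm mu gN (jp_ j) (jp' j)).
have limS : (\int[hausdorff R n.+1 n]_(x in jump_set Om (u_ j))
    (g (s_ j x) (nu_ j x))%:E)%E @[j --> \oo] -->
    (\int[hausdorff R n.+1 n]_(x in jump_set Om u) (g (s x) (nu x))%:E)%E.
  by rewrite (integral_jump_set _ _ jp); under eq_fun do rewrite surfE.
have JOm (v : 'rV[R]_n.+1 -> 'rV[R]_m) : jump_set Om v `&` Om = jump_set Om v.
  by apply/setIidPl => x [].
split=> //; rewrite /energy /bulk_energy /surface_energy JOm.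
under eq_fun do rewrite JOm.
apply: cvgeD => //; apply: fin_num_adde_defl.
by rewrite (integral_jump_set _ _ jp).
Qed.
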